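(* Let $H,T\in\mathbb C^{2n\times2n}$ be Hamiltonian, let $\alpha\in\mathbb R$, and suppose there is an invertible $\Phi=[\,\Phi_T\;\;\Phi_C\,]$ with $$H\Phi=\Phi\,\mathrm{diag}\big(\imath(\alpha I_p+N),\ \widehat H_C\big),\qquad \Phi^*J_n\Phi=\imath\,\mathrm{diag}(\Delta_T,\Delta_C),\qquad \Delta_T=\mathrm{diag}(\Gamma_1,\dots,\Gamma_m),\qquad \imath\alpha\notin\Lambda(\widehat H_C).$$ With the notation of the context, assume $\Psi_1,\dots,\Psi_m$ are all invertible, and fix $\rho\in\{1,\dots,m\}$. Suppose $F\in\mathbb C^{\rho s_\rho\times\ell}$ has full column rank and $$\Theta_\rho(S_\rho)F=F\Omega,\qquad F^*\Gamma_\rho F=\Delta_\Omega,\qquad F=[Q^T\ (Q\Omega)^T\ \dots\ (Q\Omega^{\rho-1})^T]^T,$$ where $\Omega\in\mathbb C^{\ell\times\ell}$, $Q\in\mathbb C^{s_\rho\times\ell}$ satisfies $S_\rho Q=Q\Omega^\rho$, and $\Delta_\Omega$ is a Hermitian block diagonal matrix of canonical form (see context). Assume $\Lambda(\Omega)\subseteq\Lambda(\Theta_\rho(S_\rho))$, the eigenvalues of $\Omega$ are either real or in complex conjugate pairs, and $\Lambda(\Omega)\cap(\Lambda(\Theta_\rho(S_\rho))\setminus\Lambda(\Omega))=\emptyset$. Then for $t>0$ sufficiently small there is a matrix of the form $$\widetilde\Phi_\Omega(t)=\Upsilon_\rho\begin{bmatrix}I_{s_\rho} \\ G_\rho\end{bmatrix}Q+\sum_{k=1}^m\Phi_kL_{k\rho}(t)+O(t),$$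 with $L_{k\rho}(t)=O(\delta_k(t))$ for $k\neq\rho$ and $$L_{\rho\rho}(t)=\big[\,0\ \ (Q(t^{1/\rho}\Omega))^T\ \dots\ (Q(t^{1/\rho}\Omega)^{\rho-1})^T\big]^T+O(\delta_\rho(t)),$$ such that $$(H+tT)\widetilde\Phi_\Omega(t)=\widetilde\Phi_\Omega(t)\big(\imath(\alpha I_\ell+t^{1/\rho}\widetilde\Omega(t))\big),\qquad \widetilde\Omega(t)=\Omega+O(t^{1/\rho}),$$ and $\widetilde\Phi_\Omega^*(t)J_n\widetilde\Phi_\Omega(t)=t^{1-1/\rho}(\imath\Delta_\Omega)$.
   Context: $\imath=\sqrt{-1}$; $J_n=\begin{bmatrix}0 & I_n \\ -I_n & 0\end{bmatrix}$. $H\in\mathbb C^{2n\times2n}$ is Hamiltonian if $J_nH=(J_nH)^*$. $\Lambda(\cdot)$ is the spectrum; in the conditions relating $\Lambda(\Omega)$ and $\Lambda(\Theta_\rho(S_\rho))$ spectra are multisets (eigenvalues counted with algebraic multiplicity), so the condition says that no eigenvalue of $\Omega$ is among the remaining eigenvalues of $\Theta_\rho(S_\rho)$. $^*$ is conjugate transpose. Jordan structure: integers $m\ge1$, $s_1,\dots,s_{m-1}\ge0$, $s_m>0$, $p=\sum_{j=1}^m js_j$, $N=\mathrm{diag}(N_1,\dots,N_m)$, where $N_j$ is the $j\times j$ block matrix with blocks of size $s_j\times s_j$, having $I_{s_j}$ on the first block superdiagonal and zeros elsewhere ($N_1=0_{s_1}$). For each $k$, $\Sigma_k=\mathrm{diag}(I_{t_k},-I_{s_k-t_k})$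 with an integer $0\le t_k\le s_k$, and $\Gamma_k$ is the $k\times k$ block matrix with $s_k\times s_k$ blocks having $\Sigma_k$ in every block position on the block antidiagonal and zeros elsewhere. Canonical form of $\Delta_\Omega$: $\Delta_\Omega$ is block diagonal, each diagonal block being either $\begin{bmatrix}0 & I_r \\ I_r & 0\end{bmatrix}$ for some $r$, or a block antidiagonal matrix (a $k\times k$ block matrix for some $k\ge1$) with the same signature matrix $\mathrm{diag}(I_a,-I_b)$ in each antidiagonal block; in particular $\Delta_\Omega=\Delta_\Omega^*=\Delta_\Omega^{-1}$. Partitions: $\Phi_T=[\Phi_1\ \dots\ \Phi_m]$ with $\Phi_j$ having $js_j$ columns, $\Phi_j=[\Phi_{j1}\ \dots\ \Phi_{jj}]$ with each block having $s_j$ columns; $\Upsilon_k=[\Phi_{k1}\ \Phi_{k+1,1}\ \dots\ \Phi_{m1}]$, $\Psi_k=\Upsilon_k^*(J_nT)\Upsilon_k$, $k=1,\dots,m$. For $\rho<m$: $G_\rho=-\Psi_{\rho+1}^{-1}\Upsilon_{\rho+1}^*(J_nT)\Phi_{\rho1}$ and $S_\rho=-\Sigma_\rho\Phi_{\rho1}^*(J_nT)(\Phi_{\rho1}+\Upsilon_{\rho+1}G_\rho)$. For $\rho=m$: $G_\rho$ is absent (empty) and $S_m=-\Sigma_m\Phi_{m1}^*(J_nT)\Phi_{m1}$. $\Theta_\rho(S)$ is the $\rho\times\rho$ block matrix with $s_\rho\times s_\rho$ blocks, with $I_{s_\rho}$ on the first block superdiagonal, $S$ in the bottom-left block, zeros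 elsewhere ($\Theta_1(S)=S$). Order notation: $t>0$ is real and sufficiently small; $O(t^d)$ is a matrix with norm at most a constant (independent of $t$) times $t^d$ for all sufficiently small $t>0$. For a matrix with $k$ block rows, $O([t^{d_1}\ \dots\ t^{d_k}]^T)$ means the $i$th block row is $O(t^{d_i})$. For fixed $\rho$, $\delta_k(t)$ is the following vector of length $k$ (applied to matrices with $k$ block rows of height $s_k$): for $k<\rho$, $[t^{1-k/\rho}\ t^{1-(k-1)/\rho}\ \dots\ t^{1-1/\rho}]^T$; for $k=\rho$, $[t^{1/\rho}\ t^{2/\rho}\ \dots\ t]^T$; for $k>\rho$, $[t^{1/\rho}\ t^{1/\rho}\ t^{2/\rho}\ \dots\ t\ \dots\ t]^T$, i.e. first entry $t^{1/\rho}$ and $i$th entry $t^{\min(i-1,\rho)/\rho}$ for $i\ge2$. *)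

(* Defs.v *)
From mathcomp Require Import all_boot all_order all_algebra.
From mathcomp Require Import finmap multiset spectral complex.
From mathcomp Require Import all_classical all_reals all_analysis.

Set Implicit Arguments.
Unset Strict Implicit.
Unset Printing Implicit Defensive.

Import Order.TTheory GRing.Theory Num.Theory.
Import numFieldNormedType.Exports.

Local Open Scope classical_set_scope.
Local Open Scope ring_scope.
Local Open Scope complex_scope.
Local Open Scope sesquilinear_scope.

(* All block indices are 0-based: j : 'I_m stands for the Jordan size j + 1, and
   s j is the number of Jordan blocks of that size. *)

Section Blocks.
Variable R : realType.
Local Notation C := R[i].

Definition Jmx n : 'M[C]_(n + n) := block_mx 0 1%:M (- 1%:M) 0.

Definition hamiltonian n (H : 'M[C]_(n + n)) : Prop :=
  Jmx n *m H = (Jmx n *m H)^t*.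

(* Eigenvalues counted with algebraic multiplicity. *)
Definition spectrum n (A : 'M[C]_n) : {mset C}%mset :=
  seq_mset (sval (closed_field_poly_normal (char_poly A))).

Definition signature s t : 'M[C]_s :=
  diag_mx (\row_(i < s) (if (i < t)%N then 1 else - 1)).

Definition antidiag k s (S : 'M[C]_s) : 'M[C]_(\sum_(i < k) s) :=
  \mxblock_(i < k, j < k) (if (i + j).+1 == k :> nat then S else 0).

Definition nilblock k s : 'M[C]_(\sum_(i < k) s) :=
  \mxblock_(i < k, j < k) (if j == i.+1 :> nat then 1%:M else 0 : 'M[C]_s).

Definition Theta k s (S : 'M[C]_s) : 'M[C]_(\sum_(i < k) s) :=
  \mxblock_(i < k, j < k)
    (if j == i.+1 :> nat then 1%:M
     else if (i.+1 == k) && (j == 0%N :> nat) then S else 0).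

(* Either swap [0 I; I 0], or k x k blocks with the same diag(I_a, -I_b) along
   the block antidiagonal. *)
Inductive canonical_sign_block : forall d, 'M[C]_d -> Prop :=
| CanonicalSwap r :
    canonical_sign_block (block_mx 0 1%:M 1%:M 0 : 'M[C]_(r + r))
| CanonicalAntidiag k a b :
    (0 < k)%N -> canonical_sign_block (antidiag k (signature (a + b) a)).

Definition canonical_sign_form l (D : 'M[C]_l) : Prop :=
  exists (q : nat) (d : 'I_q -> nat) (B : forall i, 'M[C]_(d i))
         (e : (\sum_(i < q) d i)%N = l),
    (forall i, canonical_sign_block (B i)) /\ D = castmx (e, e) (\mxdiag_i B i).

End Blocks.

Section Partition.
Variables (R : realType) (n m : nat) (s : 'I_m -> nat).
Local Notation C := R[i].

(* The sizes are kept as iterated sums so that the block operations of matrix.v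
   apply; the total is \sum_j (j + 1) s_j. *)
Definition jordan_dim : nat := (\sum_(j < m) \sum_(i < j.+1) s j)%N.

Definition Nmx : 'M[C]_jordan_dim := \mxdiag_(j < m) nilblock R j.+1 (s j).

Variable t : 'I_m -> nat.

Definition Sigma (j : 'I_m) : 'M[C]_(s j) := signature R (s j) (t j).

Definition Gamma (j : 'I_m) : 'M[C]_(\sum_(i < j.+1) s j) :=
  antidiag j.+1 (Sigma j).

Variable PhiT : 'M[C]_(n + n, jordan_dim).

Definition Phi (j : 'I_m) : 'M[C]_(n + n, \sum_(i < j.+1) s j) :=
  submxrow PhiT j.

Definition Phi1 (j : 'I_m) : 'M[C]_(n + n, s j) := submxrow (Phi j) ord0.

Lemma tail_ord_subproof k (i : 'I_(m - k)) : (k + i < m)%N.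
Proof. by rewrite -ltn_subRL. Qed.

Definition tail_ord k (i : 'I_(m - k)) : 'I_m := Ordinal (tail_ord_subproof i).

(* [Phi1 k  Phi1 (k+1)  ...  Phi1 (m-1)] for a 0-based k : nat, with no column
   at all when k = m. *)
Definition Upsilon k : 'M[C]_(n + n, \sum_(i < m - k) s (tail_ord i)) :=
  \mxrow_i Phi1 (tail_ord i).

Lemma Upsilon_size (k : 'I_m) :
  (s k + \sum_(i < m - k.+1) s (tail_ord i))%N =
  (\sum_(i < m - k) s (tail_ord i))%N.
Proof.
pose f x := if insub x is Some j then s j else 0%N.
have fE q : (\sum_(i < m - q) s (tail_ord i) = \sum_(i < m - q) f (q + i))%N.
  apply: eq_bigr => i _; rewrite /f; case: insubP => [j _ ji|/negP[]].
    by congr s; apply: val_inj; rewrite ji.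
  exact: tail_ord_subproof.
rewrite !fE -(subnSK (ltn_ord k)) big_ord_recl [f (k + 0)%N]/f addn0 valK.
congr addn.
by apply: eq_bigr => i _; rewrite addSnnS.
Qed.

Variable T : 'M[C]_(n + n).

Definition Psi k : 'M[C]_(\sum_(i < m - k) s (tail_ord i)) :=
  (Upsilon k)^t* *m (Jmx R n *m T) *m Upsilon k.

(* For the last index (j.+1 = m) the matrix Upsilon j.+1 has no column, so Gmx j
   is the empty matrix and Smx j reduces to - Sigma Phi1^* (J T) Phi1. *)
Definition Gmx (j : 'I_m) : 'M[C]_(\sum_(i < m - j.+1) s (tail_ord i), s j) :=
  - (invmx (Psi j.+1) *m (Upsilon j.+1)^t* *m (Jmx R n *m T) *m Phi1 j).

Definition Smx (j : 'I_m) : 'M[C]_(s j) :=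
  - (Sigma j *m (Phi1 j)^t* *m (Jmx R n *m T) *m
     (Phi1 j + Upsilon j.+1 *m Gmx j)).

(* Upsilon_j [I; G_j] *)
Definition UpsilonIG (j : 'I_m) : 'M[C]_(n + n, s j) :=
  Upsilon j *m castmx (Upsilon_size j, erefl) (col_mx 1%:M (Gmx j)).

End Partition.

Section Orders.
Variable R : realType.
Local Notation C := R[i].

(* The i-th entry of the vector delta_k(x) attached to rho; here rho, k and i
   are 1-based, 1 <= i <= k. *)
Definition delta (rho k i : nat) (x : R) : R :=
  if (k < rho)%N then x `^ (1 - (k.+1 - i)%N%:R / rho%:R)
  else if k == rho then x `^ (i%:R / rho%:R)
  else if i == 1%N then x `^ (rho%:R^-1)
  else x `^ ((minn i.-1 rho)%:R / rho%:R).

(* The norm on matrices is the library's: the maximum modulus of the entries. *)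
Definition mxO a b (A : R -> 'M[C]_(a, b)) (g : R -> R) : Prop :=
  A =O_ ((0 : R)^'+) (fun x => (g x)%:C : C^o).

Definition blockO rho k h l (A : R -> 'M[C]_(\sum_(i < k) h, l)) : Prop :=
  forall i : 'I_k, mxO (fun x => submxcol (A x) i) (delta rho k i.+1).

End Orders.

(* Main.v *)
(* Put e = t^(1/p), where p is the size of the Jordan blocks under consideration. In
   the basis Phi, H + tT becomes i(alpha + A0 - e^p B), with A0 = diag(N, invertible).
   Scaling the rows of an unknown basis Y by suitable powers of e turns
   (A0 - e^p B) Y = e Y Om' into a pencil equation G(e) Z = E(e) Z Om' with a limit at
   e = 0. This limit is solved by (Z0, Omega), with Q and G Q in the leading rows. Its
   linearization is onto: the long chains are eliminated through Psi_{p+1}, the short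
   ones and the complement through the invertibility of Omega and of the complementary
   block, and on the chain of size p there remains a Sylvester equation for Theta(S),
   solvable by the disjointness of spectra. A contraction gives Z = Z0 + O(e) and
   Om' = Omega + O(e). The Gram matrix of the scaled basis is
   e^(p-1) (Delta_Omega + O(e)), so a factor 1 + O(e) normalizes it exactly. *)

From HB Require Import structures.
Require Import Defs.
From mathcomp Require Import all_boot all_order all_algebra.
From mathcomp Require Import finmap multiset spectral complex.
From mathcomp Require Import all_classical all_reals all_analysis.
From mathcomp Require Import ring lra zify.

Set Implicit Arguments.
Unset Strict Implicit.
Unset Printing Implicit Defensive.

Import Order.TTheory GRing.Theory Num.Theory.
Import numFieldNormedType.Exports.

Local Open Scope classical_set_scope.
Local Open Scope ring_scope.
Local Open Scope complex_scope.
Local Open Scope sesquilinear_scope.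

(** Two requirements dictate the weights. [A0] has to shift them by one, to balance the factor e in
    e Y Om'; and the weights of the blocks i and k - i that Gamma_k pairs have to sum to at least p
    - 1, with equality for the chains of size p only. Then these chains alone contribute to the
    leading Gram matrix, and their contribution is F^* Gamma F = Delta_Omega. The blocks of weight 0
    are the first ones of the chains of size at least p, and B enters the limit through them only.
    The last rows of these chains, which no further block of the chain can absorb, see T only
    through Upsilon_p^* J T Upsilon_p. This is how Psi appears, and - Sigma S is the Schur
    complement of Psi_{p+1} in Psi_p; so S is invertible, and with it Omega. The linearization is
    onto but not injective, since the basis of the invariant subspace may still be changed; one
    linear right inverse is fixed, and uniqueness is never claimed. *)

(** * Entrywise norm, limits and a contraction principle for complex matrices *)

Section EntrywiseNorm.
Variable R : realType.
Local Notation C := R[i].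
Local Notation normc := (@Normc.normc R).

Lemma normc_ge0 (z : C) : 0 <= normc z.
Proof. by case: z => a b; exact: sqrtr_ge0. Qed.

Lemma normc_sum (I : finType) (F : I -> C) :
  normc (\sum_i F i) <= \sum_i normc (F i).
Proof.
apply: (big_ind2 (fun x y => normc x <= y)) => //.
  by rewrite Normc.normc0.
by move=> x1 x2 y1 y2 h1 h2; apply: le_trans (le_normcD _ _) (lerD h1 h2).
Qed.

Lemma normc_conj (z : C) : normc z^* = normc z.
Proof. by case: z => a b /=; rewrite sqrrN. Qed.

Lemma normc_real (x : R) : normc x%:C = `|x|.
Proof. by rewrite /= expr0n addr0 sqrtr_sqr. Qed.

(* Entrywise l1 norm: real-valued and submultiplicative without any
   dimension-dependent constant. *)
Definition nrm a b (A : 'M[C]_(a, b)) : R := \sum_i \sum_j normc (A i j).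

Lemma nrm_ge0 a b (A : 'M[C]_(a, b)) : 0 <= nrm A.
Proof. by do 2 apply: sumr_ge0 => ? _; exact: normc_ge0. Qed.

Lemma nrm0 a b : nrm (0 : 'M[C]_(a, b)) = 0.
Proof.
by rewrite /nrm big1 // => i _; rewrite big1 // => j _; rewrite mxE Normc.normc0.
Qed.

Lemma nrm0_eq0 a b (A : 'M[C]_(a, b)) : nrm A <= 0 -> A = 0.
Proof.
move=> A0; have /eqP : nrm A = 0 by apply/le_anti; rewrite A0 nrm_ge0.
rewrite psumr_eq0 => [/allP h|i _]; last by apply: sumr_ge0 => ? _; exact: normc_ge0.
apply/matrixP => i j; rewrite mxE; apply: Normc.eq0_normc; apply/eqP.
move: (h i (mem_index_enum _)); rewrite psumr_eq0 => [/allP|? _]; last exact: normc_ge0.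
by move/(_ j (mem_index_enum _)).
Qed.

Lemma nrmD a b (A B : 'M[C]_(a, b)) : nrm (A + B) <= nrm A + nrm B.
Proof.
rewrite /nrm -big_split; apply: ler_sum => i _; rewrite -big_split.
by apply: ler_sum => j _; rewrite mxE le_normcD.
Qed.

Lemma nrmN a b (A : 'M[C]_(a, b)) : nrm (- A) = nrm A.
Proof. by do 2 apply: eq_bigr => ? _; rewrite mxE normcN. Qed.

Lemma nrmZ a b z (A : 'M[C]_(a, b)) : nrm (z *: A) = normc z * nrm A.
Proof.
rewrite /nrm big_distrr; apply: eq_bigr => i _; rewrite big_distrr.
by apply: eq_bigr => j _; rewrite mxE Normc.normcM.
Qed.

Lemma nrmM a b c (A : 'M[C]_(a, b)) (B : 'M[C]_(b, c)) :
  nrm (A *m B) <= nrm A * nrm B.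
Proof.
have rowB i : \sum_j normc (B i j) <= nrm B.
  rewrite /nrm (bigD1 i) //= lerDl.
  by do 2 apply: sumr_ge0 => ? _; exact: normc_ge0.
rewrite {1 2}/nrm big_distrl; apply: ler_sum => i _ /=.
apply: (@le_trans _ _ (\sum_k \sum_j normc (A i j) * normc (B j k))).
  apply: ler_sum => k _; rewrite mxE; apply: le_trans (normc_sum _) _.
  by apply: ler_sum => j _; rewrite Normc.normcM.
rewrite exchange_big big_distrl; apply: ler_sum => j _ /=.
by rewrite -big_distrr /= ler_wpM2l ?normc_ge0.
Qed.

Lemma nrm_adj a b (A : 'M[C]_(a, b)) : nrm (A^t*) = nrm A.
Proof.
rewrite /nrm exchange_big; do 2 apply: eq_bigr => ? _.
by rewrite !mxE; exact: normc_conj.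
Qed.

Lemma le_nrm_entry a b (A : 'M[C]_(a, b)) i j : normc (A i j) <= nrm A.
Proof.
rewrite /nrm (bigD1 i) //= (bigD1 j) //= -addrA lerDl.
by apply: addr_ge0; do ?[apply: sumr_ge0 => ? _]; rewrite ?normc_ge0.
Qed.

Lemma nrm_le a b (A : 'M[C]_(a, b)) c :
  (forall i j, normc (A i j) <= c) -> nrm A <= (a * b)%:R * c.
Proof.
move=> h; apply: (@le_trans _ _ (\sum_(i < a) \sum_(j < b) c)).
  by do 2 apply: ler_sum => ? _.
by rewrite !sumr_const !card_ord -mulrnA mulnC mulr_natl.
Qed.

Lemma nrm_mxsub a b a' b' (f : 'I_a' -> 'I_a) (g : 'I_b' -> 'I_b)
    (A : 'M[C]_(a, b)) : injective f -> injective g ->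
  nrm (mxsub f g A) <= nrm A.
Proof.
move=> fi gi; rewrite /nrm.
under eq_bigr do under eq_bigr do rewrite mxE.
pose G i := \sum_j normc (A i j).
have Gge i : 0 <= G i by apply: sumr_ge0 => ? _; exact: normc_ge0.
apply: (@le_trans _ _ (\sum_(i < a') G (f i))).
  apply: ler_sum => i _.
  rewrite -(big_imset (fun j => normc (A (f i) j)) (A := predT)) /=; last by move=> ? ? _ _; exact: gi.
  by rewrite /G big_mkcond; apply: ler_sum => j _; case: ifP => // _; exact: normc_ge0.
rewrite -(big_imset G (A := predT)) /=; last by move=> ? ? _ _; exact: fi.
by rewrite big_mkcond; apply: ler_sum => j _; case: ifP => // _; exact: Gge.
Qed.

(** The intervals of radius 2 c / 2^n around [u n] are nested: the radius shrinks by exactly the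
    size c / 2^n of the step. The supremum of the left ends lies in all of them. *)
Lemma geometric_limit (u : nat -> R) c : 0 <= c ->
  (forall n, `|u n.+1 - u n| <= c * 2^-1 ^+ n) ->
  exists v, forall n, `|u n - v| <= 2 * c * 2^-1 ^+ n.
Proof.
move=> c0 uc; pose a n := u n - 2 * c * 2^-1 ^+ n.
pose b n := u n + 2 * c * 2^-1 ^+ n.
have h2 n : 0 <= c * 2^-1 ^+ n by rewrite mulr_ge0 // exprn_ge0 // invr_ge0.
have aS n : a n <= a n.+1.
  by have := uc n; have := h2 n; rewrite /a exprS ler_norml; set q := 2^-1 ^+ n => ? /andP[? ?]; nra.
have bS n : b n.+1 <= b n.
  by have := uc n; have := h2 n; rewrite /b exprS ler_norml; set q := 2^-1 ^+ n => ? /andP[? ?]; nra.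
have ab n : a n <= b n by have := h2 n; rewrite /a /b; set q := 2^-1 ^+ n; nra.
have am i j : (i <= j)%N -> a i <= a j.
  by apply: (@homo_leq _ a (fun x y => x <= y)) => // y x z; exact: le_trans.
have bm i j : (i <= j)%N -> b j <= b i.
  apply: (@homo_leq _ b (fun x y => y <= x)) => // y x z k1 k2; exact: le_trans k2 k1.
have abm i j : a i <= b j.
  apply: le_trans (am _ _ (leq_maxl i j)) _.
  by apply: le_trans (ab _) (bm _ _ (leq_maxr i j)).
have ub n : ubound (range a) (b n) by move=> _ [k _ <-]; exact: abm.
have sa : has_sup (range a) by split; [exists (a 0%N); exists 0%N|exists (b 0%N)].
exists (sup (range a)) => n.
have h1 : a n <= sup (range a) by apply: sup_upper_bound => //; exists n.
have h3 : sup (range a) <= b n by apply: ge_sup => //; exists (a 0%N); exists 0%N.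
by rewrite ler_norml; move: h1 h3; rewrite /a /b => ? ?; apply/andP; split; lra.
Qed.

Lemma normc_le_ReIm (z : C) : normc z <= `|complex.Re z| + `|complex.Im z|.
Proof.
case: z => a b /=; rewrite -[leRHS]ger0_norm ?addr_ge0 // -sqrtr_sqr ler_wsqrtr //.
rewrite sqrrD !real_normK ?num_real // lerD2r lerDl mulrn_wge0 // mulr_ge0 //.
Qed.

Lemma normRe_le (z : C) : `|complex.Re z| <= normc z.
Proof. by case: z => a b /=; rewrite -sqrtr_sqr ler_wsqrtr // lerDl sqr_ge0. Qed.

Lemma normIm_le (z : C) : `|complex.Im z| <= normc z.
Proof. by case: z => a b /=; rewrite -sqrtr_sqr ler_wsqrtr // lerDr sqr_ge0. Qed.

Lemma mx_geometric_limit a b (u : nat -> 'M[C]_(a, b)) c : 0 <= c ->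
  (forall n, nrm (u n.+1 - u n) <= c * 2^-1 ^+ n) ->
  exists v, exists2 d, 0 <= d & forall n, nrm (u n - v) <= d * 2^-1 ^+ n.
Proof.
move=> c0 uc.
have uRe i j : exists v, forall n, `|complex.Re (u n i j) - v| <= 2 * c * 2^-1 ^+ n.
  apply: geometric_limit => // n; apply: le_trans (uc n).
  apply: le_trans (le_nrm_entry _ i j); rewrite !mxE -raddfB; exact: normRe_le.
have uIm i j : exists v, forall n, `|complex.Im (u n i j) - v| <= 2 * c * 2^-1 ^+ n.
  apply: geometric_limit => // n; apply: le_trans (uc n).
  apply: le_trans (le_nrm_entry _ i j); rewrite !mxE -raddfB; exact: normIm_le.
have [vR hR] : exists w, forall i j n,
    `|complex.Re (u n i j) - w i j| <= 2 * c * 2^-1 ^+ n.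
  suff /choice[w hw] : forall i, exists w, forall j n,
      `|complex.Re (u n i j) - w j| <= 2 * c * 2^-1 ^+ n by exists w.
  by move=> i; have [w hw] := choice (uRe i); exists w.
have [vI hI] : exists w, forall i j n,
    `|complex.Im (u n i j) - w i j| <= 2 * c * 2^-1 ^+ n.
  suff /choice[w hw] : forall i, exists w, forall j n,
      `|complex.Im (u n i j) - w j| <= 2 * c * 2^-1 ^+ n by exists w.
  by move=> i; have [w hw] := choice (uIm i); exists w.
(* Each of the a b entries collects 2 c from its real part and 2 c from its imaginary part. *)
exists (\matrix_(i, j) (vR i j +i* vI i j)), ((a * b)%:R * (4 * c)).
  by rewrite !mulr_ge0.
move=> n; rewrite -mulrA; apply: nrm_le => i j; apply: le_trans (normc_le_ReIm _) _.
rewrite !mxE !raddfB /=; have := hR i j n; have := hI i j n.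
by set q := _ ^+ n => h1 h2; apply: le_trans (lerD h2 h1) _; nra.
Qed.

Lemma mx_contraction a b (f : 'M[C]_(a, b) -> 'M[C]_(a, b)) r :
  nrm (f 0) <= r / 2 ->
  (forall x y, nrm x <= r -> nrm y <= r -> nrm (f x - f y) <= nrm (x - y) / 2) ->
  exists2 x, nrm x <= r & f x = x.
Proof.
move=> f0 fL; have r0 : 0 <= r by have := nrm_ge0 (f 0); lra.
pose u n := iter n f 0.
have r2 n : 0 <= r / 2 * 2^-1 ^+ n :> R.
  by rewrite mulr_ge0 ?divr_ge0 // exprn_ge0 // invr_ge0.
(* The steps r/2, r/4, ... add up to r - r / 2^n, so the iterates never leave the ball on which [f]
   contracts. *)
have H n : nrm (u n) <= r - r * 2^-1 ^+ n /\ nrm (u n.+1 - u n) <= r / 2 * 2^-1 ^+ n.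
  elim: n => [|n [IH1 IH2]].
    by rewrite expr0 !mulr1 subrr nrm0 /u /= subr0.
  have h1 : nrm (u n.+1) <= r - r * 2^-1 ^+ n.+1.
    rewrite -[u n.+1](subrK (u n)); apply: le_trans (nrmD _ _) _.
    by move: IH1 IH2; rewrite exprS; set q := 2^-1 ^+ n => ? ?; nra.
  split=> //; have -> : u n.+2 - u n.+1 = f (u n.+1) - f (u n) by [].
  have := r2 n; have := r2 n.+1 => p1 p2.
  apply: le_trans (fL _ _ _ _) _; [by nra|by nra|].
  by move: IH2; rewrite exprS; set q := 2^-1 ^+ n => ?; nra.
have [v [d d0 hv]] := mx_geometric_limit (divr_ge0 r0 (ler0n _ 2)) (fun n => (H n).2).
(* Archimedean form of passing to the limit; it serves for [nrm v - r] and then for the norm of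
   [f v - v]. *)
have small (z : R) e : (forall n, z <= e * 2^-1 ^+ n) -> z <= 0.
  move=> h; rewrite leNgt; apply/negP => z0.
  have e0 : 0 <= e by have := h 0%N; rewrite expr0 mulr1; lra.
  have := archi_boundP (divr_ge0 e0 (ltW z0)); set n := Num.bound _ => hn.
  have hn2 : e / z < 2 ^+ n.
    by apply: lt_trans hn _; rewrite -natrX ltr_nat ltn_expl.
  have := h n; rewrite exprVn ler_pdivlMr ?exprn_gt0 // leNgt => /negP; apply.
  by rewrite ltr_pdivrMr // mulrC in hn2.
have vr : nrm v <= r.
  rewrite -subr_le0; apply: (small _ d) => n.
  have := (H n).1; have := r2 n; have := hv n; rewrite -nrmN opprB => h1 h2 h3.
  have : nrm v <= nrm (v - u n) + nrm (u n) by rewrite -{1}[v](subrK (u n)) nrmD.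
  lra.
exists v => //; apply/eqP; rewrite -subr_eq0; apply/eqP/nrm0_eq0.
apply: (small _ (2 * d)) => n.
have -> : f v - v = (f v - f (u n)) + (u n.+1 - v) by rewrite addrA subrK.
apply: le_trans (nrmD _ _) _.
have h1 : nrm (f v - f (u n)) <= nrm (v - u n) / 2.
  by apply: fL => //; have := (H n).1; have := r2 n; lra.
have h2 : nrm (v - u n) <= d * 2^-1 ^+ n by rewrite -nrmN opprB.
have h3 : 0 <= d * 2^-1 ^+ n by apply: le_trans h2; exact: nrm_ge0.
have h4 := hv n.+1; rewrite exprS mulrCA in h4.
set q := d * _ in h2 h3 h4; have -> : 2 * d * 2^-1 ^+ n = 2 * q by rewrite mulrA.
lra.
Qed.

End EntrywiseNorm.

(** * Orders of magnitude as e -> 0+, and a quadratic fixed point equation *)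

Section Bounds.
Variable R : realType.
Local Notation C := R[i].

(* f e = O(e ^+ k) as e -> 0+. *)
Definition bnd k a b (f : R -> 'M[C]_(a, b)) : Prop :=
  exists2 K, 0 <= K & \forall e \near (0 : R)^'+, nrm (f e) <= K * e ^+ k.

Lemma near0_unit_interval : \forall e \near (0 : R)^'+, 0 < e < 1.
Proof.
by near do (apply/andP; split=> //).
Unshelve. all: by end_near. Qed.

Lemma bnd_const a b (A : 'M[C]_(a, b)) : bnd 0 (fun=> A).
Proof.
by exists (nrm A); [exact: nrm_ge0|near=> e; rewrite expr0 mulr1].
Unshelve. all: by end_near. Qed.

Lemma bndW k j a b (f : R -> 'M[C]_(a, b)) : (j <= k)%N -> bnd k f -> bnd j f.
Proof.
move=> jk [K K0 hf]; exists K => //; near=> e.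
have /andP[e0 e1] : 0 < e < 1 by near: e; exact: near0_unit_interval.
apply: (@le_trans _ _ (K * e ^+ k)); first by near: e.
by rewrite ler_wpM2l // ler_wiXn2l // ltW.
Unshelve. all: by end_near. Qed.

Lemma bndD k a b (f g : R -> 'M[C]_(a, b)) :
  bnd k f -> bnd k g -> bnd k (fun e => f e + g e).
Proof.
move=> [K K0 hf] [L L0 hg]; exists (K + L); first exact: addr_ge0.
near=> e; apply: le_trans (nrmD _ _) _; rewrite mulrDl.
by apply: lerD; near: e.
Unshelve. all: by end_near. Qed.

Lemma bndN k a b (f : R -> 'M[C]_(a, b)) : bnd k f -> bnd k (fun e => - f e).
Proof.
by move=> [K K0 hf]; exists K => //; near=> e; rewrite nrmN; near: e.
Unshelve. all: by end_near. Qed.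

Lemma bndB k a b (f g : R -> 'M[C]_(a, b)) :
  bnd k f -> bnd k g -> bnd k (fun e => f e - g e).
Proof. by move=> hf hg; apply: bndD hf (bndN hg). Qed.

Lemma bndM k j a b c (f : R -> 'M[C]_(a, b)) (g : R -> 'M[C]_(b, c)) :
  bnd k f -> bnd j g -> bnd (k + j) (fun e => f e *m g e).
Proof.
move=> [K K0 hf] [L L0 hg]; exists (K * L); first exact: mulr_ge0.
near=> e; apply: le_trans (nrmM _ _) _; rewrite exprD mulrACA.
by apply: ler_pM; rewrite ?nrm_ge0 //; near: e.
Unshelve. all: by end_near. Qed.

Lemma bndMl k a b c (A : 'M[C]_(a, b)) (g : R -> 'M[C]_(b, c)) :
  bnd k g -> bnd k (fun e => A *m g e).
Proof. exact: (bndM (bnd_const A)). Qed.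

Lemma bndMr k a b c (f : R -> 'M[C]_(a, b)) (A : 'M[C]_(b, c)) :
  bnd k f -> bnd k (fun e => f e *m A).
Proof. by move=> /bndM/(_ (bnd_const A)); rewrite addn0. Qed.

Lemma bnd_adj k a b (f : R -> 'M[C]_(a, b)) : bnd k f -> bnd k (fun e => (f e)^t*).
Proof.
by move=> [K K0 hf]; exists K => //; near=> e; rewrite nrm_adj; near: e.
Unshelve. all: by end_near. Qed.

Lemma bndZ z k a b (f : R -> 'M[C]_(a, b)) : bnd k f -> bnd k (fun e => z *: f e).
Proof.
move=> [K K0 hf]; exists (Normc.normc z * K); first by rewrite mulr_ge0 ?normc_ge0.
near=> e; rewrite nrmZ -mulrA ler_wpM2l ?normc_ge0 //; near: e; exact: hf.
Unshelve. all: by end_near. Qed.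

Lemma bndX j k a b (f : R -> 'M[C]_(a, b)) :
  bnd k f -> bnd (j + k) (fun e => (e ^+ j)%:C *: f e).
Proof.
move=> [K K0 hf]; exists K => //; near=> e.
have e0 : 0 <= e by apply: ltW.
rewrite nrmZ normc_real ger0_norm ?exprn_ge0 // exprD mulrCA.
by rewrite ler_wpM2l ?exprn_ge0 //; near: e.
Unshelve. all: by end_near. Qed.

Lemma bnd_near k a b (f g : R -> 'M[C]_(a, b)) :
  (\forall e \near (0 : R)^'+, f e = g e) -> bnd k f -> bnd k g.
Proof.
move=> fg [K K0 hf]; exists K => //; near=> e.
have <- : f e = g e by near: e.
by near: e.
Unshelve. all: by end_near. Qed.

Lemma bnd_mxsub k a b a' b' (u : 'I_a' -> 'I_a) (v : 'I_b' -> 'I_b)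
    (f : R -> 'M[C]_(a, b)) : injective u -> injective v ->
  bnd k f -> bnd k (fun e => mxsub u v (f e)).
Proof.
move=> ui vi [K K0 hf]; exists K => //; near=> e.
by apply: le_trans (nrm_mxsub _ ui vi) _; near: e.
Unshelve. all: by end_near. Qed.

Lemma Rank_inj p (p_ : 'I_p -> nat) i : injective (@tagnat.Rank p p_ i).
Proof. by move=> x y /(congr1 val)/eqP; rewrite tagnat.eq_Rank eqxx => /eqP/val_inj. Qed.

Lemma bnd_submxcol k p (p_ : 'I_p -> nat) b (f : R -> 'M[C]_(\sum_i p_ i, b)) i :
  bnd k f -> bnd k (fun e => submxcol (f e) i).
Proof. by apply: bnd_mxsub => //; exact: Rank_inj. Qed.

Lemma usubmx_mxsub a a' b (A : 'M[C]_(a + a', b)) : usubmx A = mxsub (lshift _) id A.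
Proof. by apply/matrixP => i j; rewrite !mxE. Qed.

Lemma dsubmx_mxsub a a' b (A : 'M[C]_(a + a', b)) : dsubmx A = mxsub (@rshift _ _) id A.
Proof. by apply/matrixP => i j; rewrite !mxE. Qed.

Lemma nrm_usubmx a a' b (A : 'M[C]_(a + a', b)) : nrm (usubmx A) <= nrm A.
Proof. by rewrite usubmx_mxsub nrm_mxsub //; exact: lshift_inj. Qed.

Lemma nrm_dsubmx a a' b (A : 'M[C]_(a + a', b)) : nrm (dsubmx A) <= nrm A.
Proof. by rewrite dsubmx_mxsub nrm_mxsub //; exact: rshift_inj. Qed.

Lemma bnd_usubmx k a a' b (f : R -> 'M[C]_(a + a', b)) :
  bnd k f -> bnd k (fun e => usubmx (f e)).
Proof.
move=> [K K0 hf]; exists K => //; near=> e.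
by apply: le_trans (nrm_usubmx _) _; near: e.
Unshelve. all: by end_near. Qed.

Lemma bnd_dsubmx k a a' b (f : R -> 'M[C]_(a + a', b)) :
  bnd k f -> bnd k (fun e => dsubmx (f e)).
Proof.
move=> [K K0 hf]; exists K => //; near=> e.
by apply: le_trans (nrm_dsubmx _) _; near: e.
Unshelve. all: by end_near. Qed.

Lemma linear_bounded a b a' b' (f : {linear 'M[C]_(a, b) -> 'M[C]_(a', b')}) :
  exists2 K, 0 <= K & forall X, nrm (f X) <= K * nrm X.
Proof.
have K0 : 0 <= \sum_i \sum_j nrm (f (delta_mx i j)).
  by do 2 apply: sumr_ge0 => ? _; exact: nrm_ge0.
exists (\sum_i \sum_j nrm (f (delta_mx i j))) => // X.
rewrite {1}[X]matrix_sum_delta linear_sum /=.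
have sumle (I : finType) (F : I -> 'M[C]_(a', b')) :
    nrm (\sum_i F i) <= \sum_i nrm (F i).
  apply: (big_ind2 (fun x y => nrm x <= y)) => //; first by rewrite nrm0.
  by move=> x1 x2 y1 y2 h1 h2; apply: le_trans (nrmD _ _) (lerD h1 h2).
apply: le_trans (sumle _ _) _; rewrite mulr_suml; apply: ler_sum => i _.
rewrite linear_sum; apply: le_trans (sumle _ _) _; rewrite mulr_suml.
apply: ler_sum => j _; rewrite linearZ /= nrmZ mulrC ler_wpM2l ?nrm_ge0 //.
exact: le_nrm_entry.
Qed.

(* No regularity of X in e is claimed: the fixed point is chosen separately for
   each e, only its size is controlled. *)
Lemma quadratic_fixpoint a b (c : R -> 'M[C]_(a, b))
    (l : R -> 'M[C]_(a, b) -> 'M[C]_(a, b))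
    (q : R -> 'M[C]_(a, b) -> 'M[C]_(a, b) -> 'M[C]_(a, b)) :
  bnd 1 c ->
  (forall e x y, l e (x - y) = l e x - l e y) ->
  (forall e x y z, q e (x - y) z = q e x z - q e y z) ->
  (forall e x y z, q e x (y - z) = q e x y - q e x z) ->
  (exists2 K, 0 <= K &
    \forall e \near (0 : R)^'+, forall x, nrm (l e x) <= K * e * nrm x) ->
  (exists2 K, 0 <= K &
    \forall e \near (0 : R)^'+, forall x y, nrm (q e x y) <= K * nrm x * nrm y) ->
  exists2 X : R -> 'M[C]_(a, b), bnd 1 X &
    \forall e \near (0 : R)^'+, X e = c e + l e (X e) + q e (X e) (X e).
Proof.
move=> [Kc Kc0 hc] lB qBl qBr [Kl Kl0 hl] [Kq Kq0 hq].
(* The maps are only asked to respect subtraction: in [orthonormalize] they involve Y^* and are not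
   complex linear. *)
have l0 e : l e 0 = 0 by rewrite -{1}(subr0 0) lB subrr.
have q0 e x : q e 0 x = 0 by rewrite -{1}(subr0 0) qBl subrr.
(* The conditions on e stand under the existential, so that [choice] yields a function defined for
   every e. *)
have fix_ex e : exists x,
    0 < e -> nrm (c e) <= Kc * e ^+ 1 -> (forall x, nrm (l e x) <= Kl * e * nrm x) ->
    (forall x y, nrm (q e x y) <= Kq * nrm x * nrm y) ->
    e * (Kl + 4 * Kq * Kc) <= 2^-1 ->
    nrm x <= 2 * Kc * e /\ x = c e + l e x + q e x x.
  have [[e0 ce le qe small]|] := pselect [/\ 0 < e, nrm (c e) <= Kc * e ^+ 1,
     (forall x, nrm (l e x) <= Kl * e * nrm x),
     (forall x y, nrm (q e x y) <= Kq * nrm x * nrm y) &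
     e * (Kl + 4 * Kq * Kc) <= 2^-1]; last by move=> h; exists 0 => *; case: h.
  (* The radius is twice the bound on the constant term, as [mx_contraction] requires. In this ball
     each of the two halves of the quadratic difference has Lipschitz constant 2 Kq Kc e, whence the
     4 Kq Kc in the smallness condition. *)
  have [||x xr xE] := @mx_contraction R a b (fun x => c e + l e x + q e x x) (2 * Kc * e).
  - by rewrite l0 q0 !addr0; apply: le_trans ce _; rewrite expr1; lra.
  - move=> x y xr yr.
    have -> : c e + l e x + q e x x - (c e + l e y + q e y y) =
        l e (x - y) + (q e (x - y) x + q e y (x - y)).
      by rewrite lB qBl qBr; apply/matrixP => i j; rewrite !mxE; ring.
    apply: le_trans (nrmD _ _) _; apply: le_trans (lerD (le _) (nrmD _ _)) _.
    have h1 := qe (x - y) x; have h2 := qe y (x - y).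
    have n0 := nrm_ge0 (x - y); have nx := nrm_ge0 x; have ny := nrm_ge0 y.
    have h3 : Kq * nrm (x - y) * nrm x <= Kq * nrm (x - y) * (2 * Kc * e).
      by rewrite ler_wpM2l // mulr_ge0.
    have h4 : Kq * nrm y * nrm (x - y) <= Kq * nrm (x - y) * (2 * Kc * e).
      by rewrite mulrAC ler_wpM2l // mulr_ge0.
    have h5 : e * (Kl + 4 * Kq * Kc) * nrm (x - y) <= 2^-1 * nrm (x - y).
      by rewrite ler_wpM2r.
    apply: le_trans (_ : _ <= e * (Kl + 4 * Kq * Kc) * nrm (x - y)) _; last by lra.
    apply: le_trans (lerD (lexx _) (lerD (le_trans h1 h3) (le_trans h2 h4))) _.
    by rewrite le_eqVlt; apply/orP; left; apply/eqP; ring.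
  by exists x => *; split.
have [X hX] := choice fix_ex.
have small : \forall e \near (0 : R)^'+, e * (Kl + 4 * Kq * Kc) <= 2^-1.
  have h : 0 < 2 * (1 + Kl + 4 * Kq * Kc).
    by rewrite mulr_gt0 // -addrA ltr_pwDl ?addr_ge0 ?mulr_ge0.
  near=> e; have e0 : 0 < e by [].
  have : e < (2 * (1 + Kl + 4 * Kq * Kc))^-1.
    by near: e; apply: nbhs_right_lt; rewrite invr_gt0.
  by rewrite -[ltRHS]div1r ltr_pdivlMr // => ?; lra.
exists X; [exists (2 * Kc); first by rewrite mulr_ge0|]; near=> e.
- rewrite expr1; apply: (hX e _ _ _ _ _).1 => //; by near: e.
- apply: (hX e _ _ _ _ _).2 => //; by near: e.
Unshelve. all: by end_near. Qed.

End Bounds.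

(** * Sylvester equations and invariant subspaces *)

Section MatrixEquations.
Variable F : fieldType.

(** The section is obtained as a linear map, so that [linear_bounded] gives it a norm bound
    independent of e. *)
Lemma linear_right_inverse a b a' b' (f : {linear 'M[F]_(a, b) -> 'M[F]_(a', b')}) :
  (forall Y, exists X, f X = Y) ->
  exists g : {linear 'M[F]_(a', b') -> 'M[F]_(a, b)}, forall Y, f (g Y) = Y.
Proof.
move=> fsurj; exists (vec_mx \o (mulmxr (pinvmx (lin_mx f)) \o mxvec)) => Y /=.
apply: (can_inj mxvecK); rewrite -mul_vec_lin vec_mxK mulmxKpV //.
by have [X <-] := fsurj Y; rewrite -mul_vec_lin submxMl.
Qed.

Lemma horner_mx_intertwine a b (A : 'M[F]_a.+1) (B : 'M[F]_b.+1) (X : 'M[F]_(a.+1, b.+1)) p :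
  A *m X = X *m B -> horner_mx A p *m X = X *m horner_mx B p.
Proof.
move=> AX; elim/poly_ind: p => [|p c IH]; first by rewrite !rmorph0 mul0mx mulmx0.
rewrite !rmorphD !rmorphM /= !horner_mx_X !horner_mx_C mulmxDl mulmxDr.
by rewrite -!mulmxE -mulmxA AX mulmxA IH mulmxA scalar_mxC.
Qed.

(** If A X = X B, a Bezout relation u p_A + v p_B = 1 evaluated at A and carried through X gives X =
    X v(B) p_B(B) = 0 by Cayley-Hamilton. The map is thus injective, hence onto, as source and
    target have the same dimension. *)
Lemma sylvester a b (A : 'M[F]_a) (B : 'M[F]_b) (C : 'M[F]_(a, b)) :
  coprimep (char_poly A) (char_poly B) -> exists X, A *m X - X *m B = C.
Proof.
case: a b A B C => [|a] [|b] A B C AB.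
- by exists 0; apply/matrixP => -[].
- by exists 0; apply/matrixP => -[].
- by exists 0; apply/matrixP => ? -[].
have inj0 X : A *m X - X *m B = 0 -> X = 0.
  move/eqP; rewrite subr_eq0 => /eqP AX.
  have [[u v] /= uv] := Bezout_eq1_coprimepP _ _ AB.
  have := horner_mx_intertwine (v * char_poly B) AX.
  rewrite [in RHS]rmorphM /= Cayley_Hamilton mulr0 mulmx0.
  move: uv => /(congr1 (horner_mx A)); rewrite rmorphD rmorphM /= Cayley_Hamilton.
  by rewrite mulr0 add0r rmorph1 => ->; rewrite mul1mx.
pose f := lin_mx (mulmx A) - lin_mx (mulmxr B).
have fE X : mxvec X *m f = mxvec (A *m X - X *m B).
  by rewrite mulmxBr !mul_vec_lin /= linearB.
have fu : row_free f.
  apply/row_freeP; exists (invmx f); apply: mulmxV.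
  rewrite -row_free_unit -kermx_eq0; apply/eqP/row_matrixP => i.
  rewrite row0; have := fE (vec_mx (row i (kermx f))).
  rewrite vec_mxK -row_mul mulmx_ker row0 => /esym/(canRL mxvecK).
  by rewrite linear0 => /inj0/(canRL vec_mxK); rewrite linear0.
exists (vec_mx (mxvec C *m invmx f)); apply: (can_inj mxvecK).
by rewrite -fE vec_mxK mulmxKV // -row_free_unit.
Qed.

Lemma char_poly_intertwine a (A B U : 'M[F]_a) :
  U \in unitmx -> A *m U = U *m B -> char_poly A = char_poly B.
Proof.
move=> Uu AU; have : char_poly_mx A *m map_mx polyC U = map_mx polyC U *m char_poly_mx B.
  by rewrite /char_poly_mx mulmxBl mulmxBr -!map_mxM AU scalar_mxC.
move/(congr1 determinant); rewrite !det_mulmx [RHS]mulrC => /mulIf; apply.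
by rewrite det_map_mx polyC_eq0 -unitfE -unitmxE.
Qed.

Lemma char_poly_ublock a b (A : 'M[F]_a) (X : 'M[F]_(a, b)) (B : 'M[F]_b) :
  char_poly (block_mx A X 0 B) = char_poly A * char_poly B.
Proof.
rewrite /char_poly; have -> : char_poly_mx (block_mx A X 0 B) =
    block_mx (char_poly_mx A) (- map_mx polyC X) 0 (char_poly_mx B).
  by rewrite /char_poly_mx map_block_mx map_mx0 scalar_mx_block opp_block_mx
      add_block_mx oppr0 add0r addr0.
exact: det_ublock.
Qed.

(* In a basis that extends the columns of W, T is block upper triangular with
   diagonal blocks Om and Y; the unknown w absorbs the equation on span W, and the
   complementary equation is a Sylvester equation. *)
Lemma invariant_complement a b l (T : 'M[F]_a) (W : 'M[F]_(a, l)) (Om : 'M[F]_l) :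
  (l + b)%N = a -> \rank W = l -> T *m W = W *m Om ->
  exists Y : 'M[F]_b, char_poly T = char_poly Om * char_poly Y /\
    (coprimep (char_poly Y) (char_poly Om) ->
     forall r : 'M[F]_(a, l), exists v w, T *m v - v *m Om - W *m w = r).
Proof.
move=> ab; case: a / ab T W => T W Wr TW.
(* With full column rank the middle factor of the Gaussian decomposition of W is [1; 0], and the row
   factor can be moved to its left. *)
have [U Uu UW] : exists2 U, U \in unitmx & W = U *m col_mx 1%:M 0.
  exists (col_ebase W *m block_mx (row_ebase W) 0 0 1%:M).
    rewrite unitmx_mul col_ebase_unit unitmxE det_ublock det1 mulr1 -unitmxE.
    exact: row_ebase_unit.
  rewrite -[LHS]mulmx_ebase Wr pid_mx_col -!mulmxA; congr (_ *m _).
  by rewrite mul_col_mx mul_block_col mul1mx !mul0mx !mulmx0 mulmx1 !addr0.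
have [X [Y TU]] : exists X Y, T *m U = U *m block_mx Om X 0 Y.
  pose T' := invmx U *m T *m U.
  have : T' *m col_mx 1%:M 0 = col_mx Om 0.
    rewrite /T' -!mulmxA -UW TW UW mulmxA mulKmx //.
    by rewrite mul_col_mx mul1mx mul0mx.
  rewrite -{1}[T']submxK mul_block_col !mulmx1 !mulmx0 !addr0 => /eq_col_mx[h1 h2].
  exists (ursubmx T'), (drsubmx T'); rewrite -h1 -h2 submxK.
  by rewrite /T' !mulmxA mulmxV // mul1mx.
exists Y; split; first by rewrite (char_poly_intertwine Uu TU) char_poly_ublock.
move=> cop r; pose r' := invmx U *m r.
have [v2 hv2] := sylvester (dsubmx r') cop.
exists (U *m col_mx 0 v2), (X *m v2 - usubmx r').
rewrite mulmxA TU UW -!mulmxA -!mulmxBr mul_block_col mulmx0 add0r !mul_col_mx.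
rewrite !mul0mx mul1mx add0r !opp_col_mx !add_col_mx.
rewrite !oppr0 !addr0 subKr hv2 vsubmxK.
by rewrite /r' mulmxA mulmxV // mul1mx.
Qed.

End MatrixEquations.

(** * Spectra as multisets of roots of the characteristic polynomial *)

Section Spectrum.
Variable R : realType.
Local Notation C := R[i].

Lemma spectrumE a (A : 'M[C]_a) z : spectrum A z = mup z (char_poly A).
Proof.
rewrite /spectrum mset_seqE; case: (closed_field_poly_normal _) => s /= ->.
by rewrite (monicP (char_poly_monic A)) scale1r mu_prod_XsubC.
Qed.

Lemma root_char_poly_spectrum a (A : 'M[C]_a) z :
  root (char_poly A) z = (z \in spectrum A).
Proof.
have p0 := monic_neq0 (char_poly_monic A).
by rewrite in_mset spectrumE -XsubC_dvd // dvdp_XsubCl.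
Qed.

(** Multiplicities add in char_poly T = char_poly Om * char_poly Y, so the multiset difference is
    the spectrum of Y. Disjointness therefore makes the two factors coprime, which
    [invariant_complement] asks for. *)
Lemma spectrum_disjoint_solve a l (T : 'M[C]_a) (W : 'M[C]_(a, l)) (Om : 'M[C]_l) :
  \rank W = l -> T *m W = W *m Om ->
  (spectrum Om `&` (spectrum T `\` spectrum Om) = mset0)%mset ->
  forall r : 'M[C]_(a, l), exists v w, T *m v - v *m Om - W *m w = r.
Proof.
move=> Wr TW disj.
have la : (l + (a - l))%N = a by rewrite subnKC // -{1}Wr rank_leq_row.
have [Y [cE]] := invariant_complement la Wr TW; apply.
apply: Pdiv.ClosedField.root_coprimep => z Yz; apply/negP => Oz.
have := congr1 (fun f : {mset C}%mset => f z) disj.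
have n0 c (M : 'M[C]_c) : char_poly M != 0 := monic_neq0 (char_poly_monic M).
have mup_gt0 c (M : 'M[C]_c) : root (char_poly M) z -> (0 < mup z (char_poly M))%N.
  by rewrite -XsubC_dvd // dvdp_XsubCl.
rewrite !msetE2 !spectrumE cE mupM // mset0E addKn => /eqP.
have := mup_gt0 _ _ Oz; have := mup_gt0 _ _ Yz.
case: (mup z (char_poly Om)) => // p; case: (mup z (char_poly Y)) => // q _ _.
by rewrite minnSS.
Qed.

Lemma spectrum_inv_unit a (A : 'M[C]_a) z :
  z \notin spectrum A -> A - z%:M \in unitmx.
Proof.
by rewrite -root_char_poly_spectrum -eigenvalue_root_char /eigenvalue negbK kermx_eq0 row_free_unit.
Qed.

End Spectrum.
(* Matrix products become atoms: otherwise mxE expands them into sums, and ring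
   is very slow on the result. *)
Ltac mx_abelian :=
  repeat match goal with |- context [mulmx ?A ?B] =>
    let p := fresh "p" in set p := mulmx A B; clearbody p end;
  apply/matrixP => ? ?; rewrite !mxE; ring.

(** * Adjoints, exact normalization of a Gram matrix, and perturbation of a pencil *)

Section Adjoint.
Variable R : realType.
Local Notation C := R[i].

Lemma ctmxM a b c (A : 'M[C]_(a, b)) (B : 'M[C]_(b, c)) : (A *m B)^t* = B^t* *m A^t*.
Proof. by rewrite trmx_mul map_mxM. Qed.

Lemma ctmxD a b (A B : 'M[C]_(a, b)) : (A + B)^t* = A^t* + B^t*.
Proof. by rewrite linearD map_mxD. Qed.

Lemma ctmxN a b (A : 'M[C]_(a, b)) : (- A)^t* = - A^t*.
Proof. by rewrite linearN map_mxN. Qed.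

Lemma ctmxB a b (A B : 'M[C]_(a, b)) : (A - B)^t* = A^t* - B^t*.
Proof. by rewrite ctmxD ctmxN. Qed.

Lemma ctmxZ a b z (A : 'M[C]_(a, b)) : (z *: A)^t* = Num.conj z *: A^t*.
Proof. by rewrite linearZ map_mxZ. Qed.

Lemma ctmx1 a : (1%:M : 'M[C]_a)^t* = 1%:M.
Proof. by rewrite trmx1 map_mx1. Qed.

Lemma bnd_linear k a b a' b' (f : {linear 'M[C]_(a, b) -> 'M[C]_(a', b')}) g :
  bnd k g -> bnd k (fun e : R => f (g e)).
Proof.
have [K K0 hK] := linear_bounded f; move=> [L L0 hg]; exists (K * L); first exact: mulr_ge0.
near=> e; apply: le_trans (hK _) _; rewrite -mulrA ler_wpM2l //; near: e; exact: hg.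
Unshelve. all: by end_near. Qed.

(* Q = 1 + D Y with Y = -(W + Y^* D W + W D Y + Y^* (D X D) Y) / 2 and W = X - D:
   because Y^* occurs in the equation, every solution is Hermitian. *)
Lemma orthonormalize l (D : 'M[C]_l) (X : R -> 'M[C]_l) :
  D = D^t* -> D *m D = 1%:M -> bnd 1 (fun e => X e - D) ->
  (\forall e \near (0 : R)^'+, (X e)^t* = X e) ->
  exists2 Q : R -> 'M[C]_l, bnd 1 (fun e => Q e - 1%:M) &
    \forall e \near (0 : R)^'+, (Q e)^t* *m X e *m Q e = D.
Proof.
move=> Dh DD hX Xh; pose h : C := - 2^-1.
have [W WE] : exists W : R -> 'M[C]_l, forall e, W e = X e - D by eexists.
have W1 : bnd 1 W by apply: bnd_near hX; near=> e; rewrite WE.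
have hh : Num.conj h = h by rewrite rmorphN fmorphV rmorph_nat.
have [||||||Y Y1 hY] := @quadratic_fixpoint R l l (fun e => h *: W e)
    (fun e Y => h *: (Y^t* *m D *m W e + W e *m D *m Y))
    (fun e Y Y' => h *: (Y^t* *m (D *m X e *m D) *m Y')).
- exact: bndZ.
- move=> e x y; rewrite ctmxB !mulmxBl !mulmxBr -scalerBr; congr (_ *: _).
  by rewrite opprD addrACA.
- by move=> e x y z; rewrite ctmxB !mulmxBl -scalerBr.
- by move=> e x y z; rewrite !mulmxBr -scalerBr.
- have [K K0 hK] := W1; exists (Normc.normc h * (2 * K * nrm D)).
    by rewrite !mulr_ge0 ?nrm_ge0 ?normc_ge0.
  near=> e => Y; rewrite nrmZ -!mulrA ler_wpM2l ?normc_ge0 //.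
  have hW : nrm (W e) <= K * e by rewrite -[e in leRHS]expr1; near: e.
  have h1 := nrmM (Y^t* *m D) (W e); have h2 := nrmM (Y^t*) D.
  have h3 := nrmM (W e *m D) Y; have h4 := nrmM (W e) D.
  have nY := nrm_ge0 Y; have nW := nrm_ge0 (W e); have nD := nrm_ge0 D.
  have := nrmD (Y^t* *m D *m W e) (W e *m D *m Y); rewrite nrm_adj in h2.
  have h5 := le_trans h1 (ler_wpM2r nW h2); have h6 := le_trans h3 (ler_wpM2r nY h4).
  have h7 : nrm Y * nrm D * nrm (W e) <= nrm Y * nrm D * (K * e) by rewrite ler_wpM2l ?mulr_ge0.
  lra.
- have X0 : bnd 0 X.
    apply: (@bnd_near _ _ _ _ (fun e => X e - D + D)); first by near=> e; rewrite subrK.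
    exact: bndD (bndW _ hX) (bnd_const _).
  have [K K0 hK] : bnd 0 (fun e => D *m X e *m D) by apply: bndMr; apply: bndMl.
  exists (Normc.normc h * K); first by rewrite mulr_ge0 ?normc_ge0.
  near=> e => x y; rewrite nrmZ -!mulrA ler_wpM2l ?normc_ge0 //.
  have hKe : nrm (D *m X e *m D) <= K by rewrite -[leRHS]mulr1 -(expr0 e); near: e.
  apply: le_trans (nrmM _ _) _; rewrite mulrA ler_wpM2r ?nrm_ge0 //.
  apply: le_trans (nrmM _ _) _; rewrite nrm_adj mulrC ler_wpM2r ?nrm_ge0 //.
exists (fun e => 1%:M + D *m Y e).
  by apply: (@bnd_near _ _ _ _ (fun e => D *m Y e)); [near=> e; rewrite addrC addrA addNr add0r|exact: bndMl].
near=> e.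
have XeW : X e = D + W e by rewrite WE addrC subrK.
have Xe : (X e)^t* = X e by near: e.
have Wh : (W e)^t* = W e by rewrite WE ctmxB Xe -Dh.
have Ye : Y e = h *: (W e + ((Y e)^t* *m D *m W e + W e *m D *m Y e)
     + (Y e)^t* *m (D *m X e *m D) *m Y e).
  by rewrite (scalerDr h (_ + _)) (scalerDr h (W e)); near: e.
(* The right-hand side of [Ye] is self-adjoint whatever Y is: its two mixed terms are swapped, the
   others are fixed. *)
have Yh : (Y e)^t* = Y e.
  rewrite {1}Ye [RHS]Ye ctmxZ hh; congr (_ *: _).
  have h1 : ((Y e)^t* *m D *m W e)^t* = W e *m D *m Y e.
    by rewrite ctmxM ctmxM Wh -Dh trmxCK mulmxA.
  have h2 : (W e *m D *m Y e)^t* = (Y e)^t* *m D *m W e.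
    by rewrite -h1 trmxCK.
  have h3 : ((Y e)^t* *m (D *m X e *m D) *m Y e)^t* = (Y e)^t* *m (D *m X e *m D) *m Y e.
    have hM (a b d f g : 'M[C]_l) : (a *m (b *m d *m f) *m g)^t* = g^t* *m (f^t* *m d^t* *m b^t*) *m a^t*.
      by rewrite !ctmxM !mulmxA.
    by rewrite hM Xe -Dh trmxCK.
  have hD (a b d f : 'M[C]_l) : (a + (b + d) + f)^t* = a^t* + (b^t* + d^t*) + f^t*.
    by rewrite !ctmxD.
  apply: etrans (hD _ _ _ _) (congr2 +%R (congr2 +%R Wh _) h3).
  exact: etrans (congr2 +%R h1 h2) (addrC _ _).
move: Ye; rewrite Yh ctmxD ctmx1 ctmxM -Dh Yh => Ye.
(* For Hermitian Y and D^2 = 1, expanding (1 + Y D) (D + W) (1 + D Y) gives D plus 2 Y plus this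
   left-hand side. *)
have {}Ye : W e + (Y e *m D *m W e + W e *m D *m Y e) + Y e *m (D *m X e *m D) *m Y e
    = - (2 *: Y e).
  rewrite {5}Ye scalerA -scaleNr (_ : - (2 * h) = 1) ?scale1r //.
  by rewrite /h mulrN opprK divff.
rewrite mulmxDl mul1mx mulmxDr mulmx1 !mulmxDl !mulmxA.
rewrite {1 2 3}XeW !mulmxDl !mulmxDr.
rewrite -!mulmxA in Ye *; rewrite ?(mulmxA D D) !DD ?mul1mx ?mulmx1.
have E2 : - (2 *: Y e) = - Y e - Y e by rewrite scaler_nat mulr2n opprD.
move: Ye; rewrite E2 => Ye.
move: (Y e) (W e) (Y e *m _) (W e *m _) (Y e *m _) Ye => y a d c b Ye.
have -> : D + a + (y + b) + (y + c + d) = D + ((a + (b + c) + d) + (y + y)).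
  by mx_abelian.
by rewrite Ye -opprD addNr addr0.
Unshelve. all: by end_near. Qed.

(* Newton-type argument: with Z = Z0 + V and Om' = Om + W, a right inverse of the
   linearization at e = 0 turns the equation into a quadratic fixed point. *)
Lemma pencil_perturbation N l (G E : R -> 'M[C]_N) (G0 E0 : 'M[C]_N)
    (Om : 'M[C]_l) (Z0 : 'M[C]_(N, l)) :
  bnd 1 (fun e => G e - G0) -> bnd 1 (fun e => E e - E0) ->
  G0 *m Z0 = E0 *m Z0 *m Om ->
  (forall r : 'M[C]_(N, l), exists V W, G0 *m V - E0 *m V *m Om - E0 *m Z0 *m W = r) ->
  exists (Z : R -> 'M[C]_(N, l)) (Om' : R -> 'M[C]_l),
    [/\ bnd 1 (fun e => Z e - Z0), bnd 1 (fun e => Om' e - Om) &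
      \forall e \near (0 : R)^'+, G e *m Z e = E e *m Z e *m Om' e].
Proof.
move=> hG hE Z0E surj.
pose L (X : 'M[C]_(N + l, l)) : 'M[C]_(N, l) :=
  G0 *m usubmx X - E0 *m usubmx X *m Om - E0 *m Z0 *m dsubmx X.
have L_lin : linear L.
  move=> z X Y; rewrite /L [usubmx _]linearP [dsubmx _]linearP /=.
  rewrite !mulmxDr !mulmxDl -!scalemxAr -!scalemxAl.
  by mx_abelian.
pose Lm := GRing.isLinear.Build _ _ _ _ L L_lin.
pose LL : {linear 'M[C]_(N + l, l) -> 'M[C]_(N, l)} := HB.pack L Lm.
have [|K hK] := @linear_right_inverse _ _ _ _ _ LL.
  move=> Y; have [V [W hVW]] := surj Y; exists (col_mx V W).
  by rewrite -hVW /= /L col_mxKu col_mxKd.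
have [G' G'E] : exists G' : R -> 'M[C]_N, forall e, G' e = G e - G0 by eexists.
have [E' E'E] : exists E' : R -> 'M[C]_N, forall e, E' e = E e - E0 by eexists.
have {}hG : bnd 1 G' by apply: bnd_near hG; near=> e; rewrite G'E.
have {}hE : bnd 1 E' by apply: bnd_near hE; near=> e; rewrite E'E.
have hE0 : bnd 0 E.
  apply: (@bnd_near _ _ _ _ (fun e => E' e + E0)).
    by near=> e; rewrite E'E subrK.
  exact: bndD (bndW _ hE) (bnd_const _).
have [k k0 kb] := linear_bounded K.
(* Here E' = E - E0 and G' = G - G0. Subtracting the limit equation leaves L(V, W) = (E' Z0 Om - G'
   Z0) + (E' (V Om + Z0 W) - G' V) + E V W; the three groups are the constant, linear and quadratic
   parts below, each under the right inverse [K]. *)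
have [||||||X X1 hX] := @quadratic_fixpoint R (N + l) l
    (fun e => K (E' e *m Z0 *m Om - G' e *m Z0))
    (fun e X => K (E' e *m (usubmx X *m Om + Z0 *m dsubmx X) - G' e *m usubmx X))
    (fun e X X' => K (E e *m usubmx X *m dsubmx X')).
- by apply: bnd_linear; apply: bndB; do ?apply: bndMr.
- move=> e x y; rewrite -linearB; congr (K _).
  rewrite [usubmx _]linearB [dsubmx _]linearB /= !(mulmxBl, mulmxBr, mulmxDr).
  by mx_abelian.
- by move=> e x y z; rewrite -linearB; congr (K _); rewrite [usubmx _]linearB /= mulmxBr mulmxBl.
- by move=> e x y z; rewrite -linearB; congr (K _); rewrite [dsubmx _]linearB /= mulmxBr.
- have [a a0 ha] := hG; have [b b0 hb] := hE.
  exists (k * (b * (nrm Om + nrm Z0) + a)).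
    by rewrite mulr_ge0 // addr_ge0 ?mulr_ge0 ?addr_ge0 ?nrm_ge0.
  near=> e => x; apply: le_trans (kb _) _; rewrite -!mulrA ler_wpM2l //.
  have e0 : 0 <= e by apply: ltW.
  have hGe : nrm (G' e) <= a * e by rewrite -[e in leRHS]expr1; near: e.
  have hEe : nrm (E' e) <= b * e by rewrite -[e in leRHS]expr1; near: e.
  have nu := nrm_usubmx x; have nd := nrm_dsubmx x.
  have pO := nrm_ge0 Om; have pZ := nrm_ge0 Z0; have px := nrm_ge0 x.
  apply: le_trans (nrmD _ _) _; rewrite nrmN mulrDl.
  apply: lerD; apply: le_trans (nrmM _ _) _; last first.
    by rewrite mulrA; apply: ler_pM; rewrite ?nrm_ge0.
  rewrite -mulrA mulrCA [leRHS]mulrCA [leRHS]mulrA mulrA.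
  rewrite [leRHS](_ : _ = (b * e) * ((nrm Om + nrm Z0) * nrm x)); last by ring.
  apply: ler_pM; rewrite ?nrm_ge0 //; apply: le_trans (nrmD _ _) _; rewrite mulrDl.
  apply: lerD; apply: le_trans (nrmM _ _) _; last by rewrite ler_wpM2l.
  by rewrite mulrC ler_wpM2l.
- have [b b0 hb] := hE0; exists (k * b); first exact: mulr_ge0.
  near=> e => x y; apply: le_trans (kb _) _; rewrite -!mulrA ler_wpM2l //.
  have hEe : nrm (E e) <= b by rewrite -[leRHS]mulr1 -(expr0 e); near: e.
  apply: le_trans (nrmM _ _) _; rewrite mulrA; apply: ler_pM; rewrite ?nrm_ge0 ?nrm_dsubmx //.
  by apply: le_trans (nrmM _ _) _; apply: ler_pM; rewrite ?nrm_ge0 ?nrm_usubmx.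
exists (fun e => Z0 + usubmx (X e)), (fun e => Om + dsubmx (X e)); split.
- by apply: (bnd_near _ (bnd_usubmx X1)); near=> e; rewrite addrC addrA addNr add0r.
- by apply: (bnd_near _ (bnd_dsubmx X1)); near=> e; rewrite addrC addrA addNr add0r.
near=> e; have : X e = K (E' e *m Z0 *m Om - G' e *m Z0)
    + K (E' e *m (usubmx (X e) *m Om + Z0 *m dsubmx (X e)) - G' e *m usubmx (X e))
    + K (E e *m usubmx (X e) *m dsubmx (X e)) by near: e.
rewrite -!linearD => /(congr1 LL); rewrite hK /= /L.
move: (usubmx _) (dsubmx _) => V W.
have -> : G e = G0 + G' e by rewrite G'E addrC subrK.
have -> : E e = E0 + E' e by rewrite E'E addrC subrK.
move/eqP; rewrite -subr_eq0 => /eqP h; apply/eqP; rewrite -subr_eq0; apply/eqP.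
move: h => <-.
rewrite !(mulmxDl, mulmxDr) Z0E !mulmxA.
by mx_abelian.
Unshelve. all: by end_near. Qed.

End Adjoint.

(** * Coordinates along the Jordan chains *)

Section JordanBlocks.
Variables (R : realType) (m : nat) (s : 'I_m -> nat) (c : nat).
Local Notation C := R[i].
Local Notation jd := (\sum_(j < m) \sum_(i < j.+1) s j)%N.

(* The block is 0 when i > k, which makes the shift blk_nilblock uniform in i. *)
Definition blk l (Y : 'M[C]_(jordan_dim s + c, l)) (k : 'I_m) (i : nat) : 'M[C]_(s k, l) :=
  if insub i is Some j then submxcol (submxcol (usubmx Y : 'M[C]_(jd, l)) k) j else 0.

Definition of_blk l (y : forall k : 'I_m, nat -> 'M[C]_(s k, l)) (z : 'M[C]_(c, l)) :
    'M[C]_(jordan_dim s + c, l) :=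
  col_mx (\mxcol_(k < m) \mxcol_(i < k.+1) y k i) z.

Lemma blkE l (Y : 'M[C]_(jordan_dim s + c, l)) (k : 'I_m) (i : 'I_k.+1) :
  blk Y k i = submxcol (submxcol (usubmx Y : 'M[C]_(jd, l)) k) i.
Proof. by rewrite /blk valK. Qed.

Lemma blk_default l (Y : 'M[C]_(jordan_dim s + c, l)) (k : 'I_m) i : (k < i)%N -> blk Y k i = 0.
Proof. by move=> ki; rewrite /blk insubF // ltnS leqNgt ki. Qed.

Lemma blk_of_blk l y (z : 'M[C]_(c, l)) (k : 'I_m) i : (i <= k)%N -> blk (of_blk y z) k i = y k i.
Proof.
move=> ik; have -> : i = Ordinal (ik : i < k.+1)%N by [].
by rewrite blkE /of_blk col_mxKu !mxcolK.
Qed.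

Lemma of_blkK l (Y : 'M[C]_(jordan_dim s + c, l)) : of_blk (blk Y) (dsubmx Y) = Y.
Proof.
rewrite /of_blk -[RHS]vsubmxK; congr col_mx.
rewrite -[RHS](@submxcolK _ _ _ _ (usubmx Y : 'M[C]_(jd, l))); apply/eq_mxcol => k.
by rewrite -[RHS]submxcolK; apply/eq_mxcol => i; rewrite blkE.
Qed.

Lemma blkP l (Y Y' : 'M[C]_(jordan_dim s + c, l)) :
  (forall (k : 'I_m) i, (i <= k)%N -> blk Y k i = blk Y' k i) -> dsubmx Y = dsubmx Y' -> Y = Y'.
Proof.
move=> h hC; rewrite -[Y]of_blkK -[Y']of_blkK hC /of_blk; congr col_mx.
apply/eq_mxcol => k; apply/eq_mxcol => i.
by rewrite h // -ltnS.
Qed.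

Lemma blkD l (Y Y' : 'M[C]_(jordan_dim s + c, l)) k i : blk (Y + Y') k i = blk Y k i + blk Y' k i.
Proof.
rewrite /blk; case: insubP => [j _ _|_]; last by rewrite addr0.
by rewrite [usubmx _]linearD -!submxcolD.
Qed.

Lemma blkN l (Y : 'M[C]_(jordan_dim s + c, l)) k i : blk (- Y) k i = - blk Y k i.
Proof.
rewrite /blk; case: insubP => [j _ _|_]; last by rewrite oppr0.
by rewrite [usubmx _]linearN -!submxcolN.
Qed.

Lemma blkB l (Y Y' : 'M[C]_(jordan_dim s + c, l)) k i : blk (Y - Y') k i = blk Y k i - blk Y' k i.
Proof. by rewrite blkD blkN. Qed.

Lemma blk_mulmx l l' (Y : 'M[C]_(jordan_dim s + c, l)) (A : 'M[C]_(l, l')) k i :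
  blk (Y *m A) k i = blk Y k i *m A.
Proof.
rewrite /blk; case: insubP => [j _ _|_]; last by rewrite mul0mx.
by rewrite -mul_usub_mx !submxcol_mul.
Qed.

Lemma bnd_blk d l (Y : R -> 'M[C]_(jordan_dim s + c, l)) k i :
  bnd d Y -> bnd d (fun e => blk (Y e) k i).
Proof.
rewrite /blk; case: insubP => [j _ _|_] hY.
  by apply: bnd_submxcol; apply: bnd_submxcol; exact: bnd_usubmx.
by exists 0 => //; near=> e; rewrite nrm0 mul0r.
Unshelve. all: by end_near. Qed.

Definition scalblk (w : 'I_m -> nat -> nat) (f : nat -> C) (g : C) : 'M[C]_(jordan_dim s + c) :=
  block_mx (\mxdiag_(k < m) \mxdiag_(i < k.+1) (f (w k i))%:M) 0 0 g%:M.

Lemma usubmx_diag l (A : 'M[C]_(jordan_dim s)) (B : 'M[C]_c) (Y : 'M[C]_(jordan_dim s + c, l)) :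
  usubmx (block_mx A 0 0 B *m Y) = A *m usubmx Y.
Proof. by rewrite -[Y in LHS]vsubmxK mul_block_col col_mxKu mul0mx addr0. Qed.

Lemma dsubmx_diag l (A : 'M[C]_(jordan_dim s)) (B : 'M[C]_c) (Y : 'M[C]_(jordan_dim s + c, l)) :
  dsubmx (block_mx A 0 0 B *m Y) = B *m dsubmx Y.
Proof. by rewrite -[Y in LHS]vsubmxK mul_block_col col_mxKd mul0mx add0r. Qed.

Lemma submxcol_mxdiag p (p_ : 'I_p -> nat) l (A : forall i, 'M[C]_(p_ i)) (Y : 'M[C]_(\sum_i p_ i, l)) j :
  submxcol (\mxdiag_i A i *m Y) j = A j *m submxcol Y j.
Proof. by rewrite -[Y in LHS]submxcolK mul_mxdiag_mxcol mxcolK. Qed.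

Lemma blk_scalblk l w f g (Y : 'M[C]_(jordan_dim s + c, l)) (k : 'I_m) i :
  blk (scalblk w f g *m Y) k i = f (w k i) *: blk Y k i.
Proof.
rewrite /blk; case: insubP => [j _ <-|_]; last by rewrite scaler0.
by rewrite usubmx_diag !submxcol_mxdiag mul_scalar_mx.
Qed.

Lemma dsubmx_scalblk l w f g (Y : 'M[C]_(jordan_dim s + c, l)) :
  dsubmx (scalblk w f g *m Y) = g *: dsubmx Y.
Proof. by rewrite dsubmx_diag mul_scalar_mx. Qed.

Lemma nrm_scalblk w f g (b : R) : 0 <= b ->
  (forall k i, Normc.normc (f (w k i)) <= b) -> Normc.normc g <= b ->
  nrm (scalblk w f g) <= ((jordan_dim s + c) * (jordan_dim s + c))%:R * b.
Proof.
move=> b0 hf hg; apply: nrm_le.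
have scal d (z : C) : Normc.normc z <= b -> forall i j, Normc.normc ((z%:M : 'M[C]_d) i j) <= b.
  by move=> hz i j; rewrite mxE; case: eqP => _; rewrite ?mulr1n ?mulr0n ?Normc.normc0.
have diag p (p_ : 'I_p -> nat) (A : forall i, 'M[C]_(p_ i)) :
    (forall k i j, Normc.normc (A k i j) <= b) ->
    forall i j, Normc.normc ((\mxdiag_k A k) i j) <= b.
  move=> hA i j; rewrite mxE.
  move: (tagnat.sig1 i) (tagnat.sig2 i) (tagnat.sig1 j) (tagnat.sig2 j) => i1 i2 j1 j2.
  case: eqVneq => [ij|_]; last by rewrite mxE Normc.normc0.
  by case: _ / ij j2 => j2; rewrite conform_mx_id.
move=> i j; rewrite /scalblk -(splitK i) -(splitK j).
case: (fintype.split i) => i'; case: (fintype.split j) => j' /=.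
- rewrite block_mxEul; apply: (diag m) => k; apply: (diag k.+1) => q; exact: scal.
- by rewrite block_mxEur mxE Normc.normc0.
- by rewrite block_mxEdl mxE Normc.normc0.
- by rewrite block_mxEdr; apply: scal.
Qed.

Lemma blk_nilblock l (M : 'M[C]_c) (Y : 'M[C]_(jordan_dim s + c, l)) (k : 'I_m) i : (i <= k)%N ->
  blk (block_mx (Nmx R s) 0 0 M *m Y) k i = blk Y k i.+1.
Proof.
move=> ik; have -> : i = Ordinal (ik : i < k.+1)%N by [].
rewrite blkE usubmx_diag submxcol_mxdiag -[submxcol (usubmx Y) k]submxcolK.
rewrite mul_mxblock_mxrow mxcolK /=; have [ki|ki] := leqP k i.
  rewrite blk_default // big1 // => j _; case: eqP => [ji|_]; last by rewrite mul0mx.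
  by have := ltn_ord j; rewrite ji ltnS ltnNge ki.
have -> : i.+1 = Ordinal (ki : i.+1 < k.+1)%N by [].
rewrite blkE (bigD1 (Ordinal (ki : i.+1 < k.+1)%N)) //= eqxx mul1mx big1 ?addr0 //.
move=> j ji; case: eqP => [jE|_]; last by rewrite mul0mx.
by case/eqP: ji; apply: val_inj.
Qed.

Lemma blk_antidiag l (S : forall k, 'M[C]_(s k)) (M : 'M[C]_c)
    (Y : 'M[C]_(jordan_dim s + c, l)) (k : 'I_m) i : (i <= k)%N ->
  blk (block_mx (\mxdiag_(k < m) antidiag k.+1 (S k)) 0 0 M *m Y) k i = S k *m blk Y k (k - i).
Proof.
move=> ik; have -> : i = Ordinal (ik : i < k.+1)%N by [].
rewrite blkE usubmx_diag submxcol_mxdiag -[submxcol (usubmx Y) k]submxcolK.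
rewrite mul_mxblock_mxrow mxcolK /=.
have ki : (k - i < k.+1)%N by rewrite ltnS leq_subr.
have -> : (k - i)%N = Ordinal ki by [].
rewrite blkE (bigD1 (Ordinal ki)) //= subnKC // eqxx big1 ?addr0 // => j ji.
case: eqP => [[jE]|_]; last by rewrite mul0mx.
by case/eqP: ji; apply: val_inj; rewrite /= -(addKn i j) jE.
Qed.

Lemma submxcol_adj p (p_ : 'I_p -> nat) a l (A : 'M[C]_(a, \sum_i p_ i)) (Z : 'M[C]_(a, l)) j :
  submxcol (A^t* *m Z) j = (submxrow A j)^t* *m Z.
Proof. by rewrite -submxcol_mul; congr (_ *m _); apply/matrixP => x y; rewrite !mxE. Qed.

Lemma blk_adj n l (PhiT : 'M[C]_(n, jordan_dim s)) (PhiC : 'M[C]_(n, c)) (Z : 'M[C]_(n, l))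
    (k : 'I_m) (i : 'I_k.+1) :
  blk ((row_mx PhiT PhiC)^t* *m Z) k i = (submxrow (submxrow (PhiT : 'M[C]_(n, jd)) k) i)^t* *m Z.
Proof.
rewrite blkE; have -> : usubmx ((row_mx PhiT PhiC)^t* *m Z) = PhiT^t* *m Z.
  by rewrite tr_row_mx map_col_mx mul_col_mx col_mxKu.
by rewrite (submxcol_adj (PhiT : 'M[C]_(n, jd))) submxcol_adj.
Qed.

Lemma adj_mul_blk l l' (Y : 'M[C]_(jordan_dim s + c, l)) (Y' : 'M[C]_(jordan_dim s + c, l')) :
  Y^t* *m Y' = \sum_(k < m) \sum_(i < k.+1) (blk Y k i)^t* *m blk Y' k i
     + (dsubmx Y)^t* *m dsubmx Y'.
Proof.
rewrite -{1}[Y]of_blkK -{1}[Y']of_blkK /of_blk tr_col_mx map_row_mx mul_row_col; congr (_ + _).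
have adjcol p (p_ : 'I_p -> nat) (A : forall i, 'M[C]_(p_ i, l)) :
    (\mxcol_i A i)^t* = \mxrow_i (A i)^t*.
  by apply/matrixP => x y; rewrite !mxE.
rewrite adjcol mul_mxrow_mxcol; apply: eq_bigr => k _.
by rewrite adjcol mul_mxrow_mxcol.
Qed.

Lemma row_mul_blk n l (PhiT : 'M[C]_(n, jordan_dim s)) (PhiC : 'M[C]_(n, c))
    (Y : 'M[C]_(jordan_dim s + c, l)) :
  row_mx PhiT PhiC *m Y =
  \sum_(k < m) submxrow (PhiT : 'M[C]_(n, jd)) k *m \mxcol_(i < k.+1) blk Y k i
     + PhiC *m dsubmx Y.
Proof.
rewrite -{1}[Y]of_blkK /of_blk mul_row_col; congr (_ + _).
by rewrite -{1}[PhiT](@submxrowK _ _ _ _ (PhiT : 'M[C]_(n, jd))) mul_mxrow_mxcol.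
Qed.

End JordanBlocks.

(** * Weights, and the rescaled pencil at e = 0 *)

Section LeadingOrder.
Variables (R : realType) (m : nat) (s : 'I_m -> nat) (c : nat) (rho : 'I_m).
Local Notation C := R[i].

(* With e = t^(1/p), p = rho + 1 (all indices are 0-based), block i of chain k of
   the invariant subspace has order e^(wt k i); the complementary rows have weight
   p. Consecutive blocks satisfy wtS, so that A0 diag(e^wt) = diag(e^min(wt+1,p)) A0. *)
Definition wt (k : 'I_m) (i : nat) : nat :=
  if (k < rho)%N then (rho - k + i)%N else minn i rho.+1.

Lemma wt_eq0 (k : 'I_m) i : (wt k i == 0%N) = (rho <= k)%N && (i == 0%N).
Proof. by rewrite /wt; case: ifP => ?; lia. Qed.

Lemma wtS (k : 'I_m) i : (i < k)%N -> wt k i.+1 = minn (wt k i).+1 rho.+1.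
Proof. by rewrite /wt; case: ifP => ? ?; lia. Qed.

Definition scal (f : nat -> C) : 'M[C]_(jordan_dim s + c) := scalblk s c wt f (f rho.+1).

(* P0, P1, P2 are the limits at e = 0 of the scalings e^wt, e^(p - min(wt+1,p)) and
   e^(wt + 1 - min(wt+1,p)) of the rescaled pencil. *)
Definition P0 := scal (fun d => (d == 0)%N%:R).
Definition P1 := scal (fun d => (rho <= d)%N%:R).
Definition P2 := scal (fun d => (d <= rho)%N%:R).

Variables (B : 'M[C]_(jordan_dim s + c)) (M : 'M[C]_c).

Definition A0 : 'M[C]_(jordan_dim s + c) := block_mx (Nmx R s) 0 0 M.
Definition G0 := A0 - P1 *m B *m P0.

(** In [G0] the matrix B acts after [P0], so its contribution is known once the first blocks of the
    chains k >= rho are. This is why [extend_blocks] may fix u before it constructs the other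
    blocks. *)
Lemma P0_eq l (V V' : 'M[C]_(jordan_dim s + c, l)) :
  (forall k : 'I_m, (rho <= k)%N -> blk V k 0 = blk V' k 0) -> P0 *m V = P0 *m V'.
Proof.
move=> h; apply: blkP => [k i ik|]; last by rewrite !dsubmx_scalblk !scale0r.
rewrite !blk_scalblk wt_eq0; case: (leqP rho k) => [rk|_]; last by rewrite !scale0r.
by case: eqP => [->|_]; rewrite ?scale0r // h.
Qed.

(* Chains longer than rho are solved forwards from their first block, shorter ones
   backwards from their last block, where Om has to be inverted. *)
Lemma extend_blocks l (Om : 'M[C]_l) (x : forall k : 'I_m, nat -> 'M[C]_(s k, l))
    (r u : 'M[C]_(jordan_dim s + c, l)) :
  M \in unitmx -> Om \in unitmx ->
  B *m (P0 *m of_blk x (0 : 'M[C]_(c, l))) = u ->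
  (forall i, (i < rho)%N -> x rho i.+1 = x rho i *m Om + blk r rho i) ->
  - blk u rho rho = x rho rho *m Om + blk r rho rho ->
  (forall k : 'I_m, (rho < k)%N -> - blk u k k = blk r k k) ->
  exists V : 'M[C]_(jordan_dim s + c, l),
    [/\ forall i, (i <= rho)%N -> blk V rho i = x rho i,
        forall k : 'I_m, (rho <= k)%N -> blk V k 0 = x k 0%N &
        G0 *m V - P2 *m V *m Om = r].
Proof.
move=> Mu Ou uE0 h1 h2 h3.
pose fw (k : 'I_m) := fix fw i := if i is j.+1 then
  (rho <= wt k j)%N%:R *: blk u k j + (wt k j <= rho)%N%:R *: (fw j *m Om) + blk r k j
  else x k 0%N.
(* [bw] counts from the end: [bw k j] is block k + 1 - j, and the initial 0 stands for the position
   after the last block. *)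
pose bw (k : 'I_m) := fix bw j := if j is i.+1 then
  (bw i - (rho <= wt k (k - i))%N%:R *: blk u k (k - i) - blk r k (k - i)) *m invmx Om
  else 0 : 'M[C]_(s k, l).
pose y (k : 'I_m) i := if (k < rho)%N then bw k (k.+1 - i)%N
  else if (rho < k)%N then fw k i else x k i.
have yrho i : y rho i = x rho i by rewrite /y ltnn.
have yhead (k : 'I_m) : (rho <= k)%N -> y k 0%N = x k 0%N.
  by rewrite /y ltnNge => ->; case: ltnP.
exists (of_blk y (invmx M *m (dsubmx u + dsubmx r))); split.
- by move=> i ir; rewrite blk_of_blk.
- by move=> k rk; rewrite blk_of_blk // yhead.
set V := of_blk _ _.
have uE : B *m (P0 *m V) = u.
  by rewrite -uE0; congr (_ *m _); apply: P0_eq => k rk; rewrite !blk_of_blk // yhead.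
rewrite /G0 mulmxBl -!mulmxA uE; apply: blkP => [k i ik|]; last first.
  rewrite !linearB /= dsubmx_diag !mulmxA.
  rewrite -[P2 *m V *m Om]mulmxA !dsubmx_scalblk /V col_mxKd mulKVmx //.
  by rewrite leqnSn scale1r ltnn scale0r subr0 addrC addKr.
rewrite !blkB /A0 blk_nilblock // !mulmxA -mulmxA !blk_scalblk blk_mulmx.
rewrite (blk_of_blk y _ ik) /=.
have VS : blk V k i.+1 = if (i < k)%N then y k i.+1 else 0.
  by case: ltnP => ki; [rewrite blk_of_blk|rewrite blk_default].
rewrite VS /y; case: (ltngtP k rho) => kr.
- have -> : (k.+1 - i = (k - i).+1)%N by rewrite subSn.
  rewrite /= subKn // mulmxKV // subSS.
  have -> : (wt k i <= rho)%N by rewrite /wt kr; lia.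
  rewrite scale1r; case: ltnP => ki; first by rewrite opprB addrC subrK.
  rewrite (_ : (k - i = 0)%N) /=; last by apply/eqP; rewrite subn_eq0.
  by rewrite opprB addrC subrK.
- case: ltnP => ki /=; first by rewrite -addrA -opprD addrC addKr.
  (* The last row of a long chain: the weight is rho + 1, so the Om term has vanished and no next
     block is available. Only the condition [h3] on u remains. *)
  have ii : i = k by apply/eqP; rewrite eqn_leq ik.
  rewrite ii -h3 //; have -> : (rho <= wt k k)%N
    by rewrite /wt; case: ifP => ?; move: (nat_of_ord k) (nat_of_ord rho) kr => p q ?; lia.
  have -> : (wt k k <= rho)%N = false
    by rewrite /wt; case: ifP => ?; move: (nat_of_ord k) (nat_of_ord rho) kr => p q ?; lia.
  by rewrite scale0r scale1r sub0r subr0.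
- have {}kr : k = rho by apply: val_inj.
  rewrite {k}kr in ik VS *; have -> : wt rho i = i by rewrite /wt ltnn; lia.
  rewrite ik scale1r; case: ltnP => ki.
    by rewrite scale0r subr0 h1 // addrC addKr.
  have -> : i = rho by apply/eqP; rewrite eqn_leq ik.
  by rewrite scale1r sub0r h2 addrC addKr.
Qed.

End LeadingOrder.

(** * Block rows of Theta, and the tails Upsilon *)

Lemma unitmx_dim0 (F : fieldType) a (A : 'M[F]_a) : a = 0%N -> A \in unitmx.
Proof. by case: a A => // A _; rewrite unitmxE det_mx00 unitr1. Qed.

Lemma signature_sq (R : realType) a b : signature R a b *m signature R a b = 1%:M.
Proof.
apply/matrixP => i j; rewrite /signature mul_diag_mx !mxE.
by case: eqP => [->|_]; rewrite ?mulr0n ?mulr0 // !mulr1n; case: ifP; rewrite ?mulrNN mulr1.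
Qed.

Section ThetaAction.
Variables (R : realType) (k d l : nat) (S : 'M[R[i]]_d).
Variable x : 'M[R[i]]_(\sum_(i < k.+1) d, l).

Lemma submxcol_Theta (i j : 'I_k.+1) : j = i.+1 :> nat ->
  submxcol (Theta k.+1 S *m x) i = submxcol x j.
Proof.
move=> ji; rewrite -{1}[x]submxcolK mul_mxblock_mxrow mxcolK (bigD1 j) //= ji eqxx mul1mx.
rewrite big1 ?addr0 // => j' j'j; rewrite ifN; last first.
  by rewrite -ji; apply: contraNneq j'j => /val_inj ->.
by rewrite eqSS (ltn_eqF (_ : i < k)%N) ?mul0mx // -ltnS -ji.
Qed.

Lemma submxcol_Theta_max : submxcol (Theta k.+1 S *m x) ord_max = S *m submxcol x ord0.
Proof.
rewrite -{1}[x]submxcolK mul_mxblock_mxrow mxcolK (bigD1 ord0) //= eqxx big1 ?addr0 //.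
move=> j j0; rewrite ifN; last by rewrite (ltn_eqF (ltn_ord j)).
by rewrite (_ : (j == 0 :> nat)%N = false) ?mul0mx //; apply/negbTE.
Qed.

End ThetaAction.

Section Tails.
Variables (R : realType) (n m : nat) (s : 'I_m -> nat).
Local Notation C := R[i].

(** Block sizes depend on the index, so indices that are merely provably equal give different types.
    With [q], [u] and [u'] abstract, these equalities can be eliminated. *)
Lemma mxrow_cons a (b : forall k : 'I_m, 'M[C]_(a, s k)) q q'
    (u : 'I_q -> 'I_m) (u' : 'I_q' -> 'I_m) k
    (sz : (s k + \sum_i s (u' i) = \sum_i s (u i))%N) :
  q = q'.+1 -> (forall i : 'I_q, i = 0%N :> nat -> u i = k) ->
  (forall (i : 'I_q) (i' : 'I_q'), i = i'.+1 :> nat -> u i = u' i') ->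
  \mxrow_i b (u i) = castmx (erefl, sz) (row_mx (b k) (\mxrow_i b (u' i))).
Proof.
move=> qE; case: _ / (esym qE) u sz => u sz h0 hS.
have ek : k = u ord0 by rewrite h0.
have eu : u' = (fun i => u (lift ord0 i)) by apply: funext => i; rewrite (hS _ i).
case: _ / (esym ek) sz; case: _ / (esym eu) => sz.
by rewrite mxrow_recl; congr castmx; congr pair; exact: Prop_irrelevance.
Qed.

Variable PhiT : 'M[C]_(n + n, jordan_dim s).

Lemma Upsilon_cons (k : 'I_m) :
  Upsilon PhiT k = castmx (erefl, Upsilon_size s k) (row_mx (Phi1 PhiT k) (Upsilon PhiT k.+1)).
Proof.
apply: (@mxrow_cons _ (Phi1 PhiT)) => [|i i0|i i' ii'].
- by rewrite subnSK.
- by apply: val_inj; rewrite /= i0 addn0.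
- by apply: val_inj; rewrite /= ii' addSnnS.
Qed.

Lemma mul_castmx_row_col a b b' b'' d (e : (b + b')%N = b'') (A : 'M[C]_(a, b)) (A' : 'M[C]_(a, b'))
    (D : 'M[C]_(b, d)) (D' : 'M[C]_(b', d)) :
  castmx (erefl, e) (row_mx A A') *m castmx (e, erefl) (col_mx D D') = A *m D + A' *m D'.
Proof. by case: _ / e; rewrite !castmx_id mul_row_col. Qed.

Lemma UpsilonIGE T (k : 'I_m) :
  UpsilonIG PhiT T k = Phi1 PhiT k + Upsilon PhiT k.+1 *m Gmx PhiT T k.
Proof. by rewrite /UpsilonIG Upsilon_cons mul_castmx_row_col mulmx1. Qed.

Lemma Upsilon_mul l k (g : 'M[C]_(\sum_(i < m - k) s (tail_ord i), l)) :
  Upsilon PhiT k *m g = \sum_i Phi1 PhiT (tail_ord i) *m submxcol g i.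
Proof. by rewrite -{1}[g]submxcolK mul_mxrow_mxcol. Qed.

Lemma Upsilon_adj_mul l k (Z : 'M[C]_(n + n, l)) (i : 'I_(m - k)) :
  submxcol ((Upsilon PhiT k)^t* *m Z) i = (Phi1 PhiT (tail_ord i))^t* *m Z.
Proof. by rewrite submxcol_adj mxrowK. Qed.

(** At most one i satisfies the condition, since [tail_ord] is injective. The sum and [conform_mx]
    carry the block of that i to the type indexed by j, with value 0 when j < k. *)
Definition tail_family l k (g : 'M[C]_(\sum_(i < m - k) s (tail_ord i), l)) (j : 'I_m) :
    'M[C]_(s j, l) :=
  \sum_(i | tail_ord i == j) conform_mx 0 (submxcol g i).

Lemma tail_family_sum l k (g : 'M[C]_(\sum_(i < m - k) s (tail_ord i), l)) :
  \sum_(j : 'I_m | (k <= j)%N) Phi1 PhiT j *m tail_family g j = Upsilon PhiT k *m g.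
Proof.
rewrite Upsilon_mul (partition_big (fun i => tail_ord i) (fun j : 'I_m => (k <= j)%N)) /=.
  apply: eq_bigr => j _; rewrite mulmx_sumr; apply: eq_bigr => i /eqP ij.
  by case: _ / ij; rewrite conform_mx_id.
by move=> i _; rewrite leq_addr.
Qed.

Lemma tail_ord_surj k (j : 'I_m) : (k <= j)%N -> exists i : 'I_(m - k), tail_ord i = j.
Proof.
move=> kj; have h : (j - k < m - k)%N by rewrite ltn_sub2r // (leq_ltn_trans kj).
by exists (Ordinal h); apply: val_inj; rewrite /= subnKC.
Qed.

End Tails.

(** * Solving the limit system and its linearization *)

Section LeadingSystem.
Variables (R : realType) (n : nat) (T : 'M[R[i]]_(n + n)).
Variables (m : nat) (s t : 'I_m -> nat) (c : nat).
Variables (PhiT : 'M[R[i]]_(n + n, jordan_dim s)) (PhiC : 'M[R[i]]_(n + n, c)).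
Variable DeltaC : 'M[R[i]]_c.
Local Notation C := R[i].
Local Notation Phi := (row_mx PhiT PhiC).
Local Notation Sg := (Sigma R s t).
Local Notation JT := (Jmx R n *m T).
Local Notation Delta := (block_mx (\mxdiag_j Gamma R s t j) 0 0 DeltaC).
Hypothesis hJPhi : Phi^t* *m Jmx R n *m Phi = 'i%C *: Delta.
Hypothesis hPsi : forall k : 'I_m, Psi PhiT T k \in unitmx.
Variable B : 'M[C]_(jordan_dim s + c).
Hypothesis hB : T *m Phi = - 'i%C *: (Phi *m B).
Variable rho : 'I_m.
Local Notation P0 := (P0 R s c rho).
Local Notation S := (Smx t PhiT T rho).
Local Notation G := (Gmx PhiT T rho).
Local Notation U' := (Upsilon PhiT rho.+1).

Lemma Sg_sq k : Sg k *m Sg k = 1%:M.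
Proof. exact: signature_sq. Qed.

Lemma Psi_unit : Psi PhiT T rho.+1 \in unitmx.
Proof.
have [rm|mr] := ltnP rho.+1 m; first by rewrite (hPsi (Ordinal rm)).
by apply: unitmx_dim0; apply: big1 => i; have := ltn_ord i; lia.
Qed.

(** By Phi^* J Phi = i Delta and the antidiagonal form of Gamma_k, pairing with the first vectors of
    chain k reads off the last block of B X; the factors - i and i cancel. *)
Lemma Phi1_JT l k (X : 'M[C]_(jordan_dim s + c, l)) :
  (Phi1 PhiT k)^t* *m JT *m (Phi *m X) = Sg k *m blk (B *m X) k k.
Proof.
rewrite -[LHS]mulmxA -(blk_adj PhiT PhiC (JT *m (Phi *m X)) (ord0 : 'I_k.+1)) -!mulmxA.
rewrite (mulmxA T) hB -!scalemxAl -!scalemxAr -!mulmxA !mulmxA hJPhi.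
rewrite -!scalemxAl scalerA mulNr -expr2 sqr_i opprK scale1r -mulmxA.
by rewrite (@blk_antidiag _ _ _ _ _ Sg) // subn0.
Qed.

Lemma Phi_P0 l (V : 'M[C]_(jordan_dim s + c, l)) :
  Phi *m (P0 *m V) = \sum_(k : 'I_m | (rho <= k)%N) Phi1 PhiT k *m blk V k 0.
Proof.
rewrite row_mul_blk dsubmx_scalblk scale0r mulmx0 addr0 [RHS]big_mkcond.
apply: eq_bigr => k _; rewrite -[submxrow _ k]submxrowK mul_mxrow_mxcol.
rewrite (bigD1 ord0) //= big1 ?addr0 => [|i i0]; rewrite blk_scalblk wt_eq0.
  by rewrite eqxx andbT; case: ifP; rewrite ?scale1r // scale0r mulmx0.
by rewrite (_ : (i == 0 :> nat) = false) ?andbF ?scale0r ?mulmx0 //; apply/negbTE.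
Qed.

Lemma SmxE : Sg rho *m S = - ((Phi1 PhiT rho)^t* *m JT *m UpsilonIG PhiT T rho).
Proof. by rewrite /Smx UpsilonIGE mulmxN !mulmxA Sg_sq mul1mx. Qed.

Lemma GmxE : Psi PhiT T rho.+1 *m G = - (U'^t* *m JT *m Phi1 PhiT rho).
Proof.
rewrite /Gmx mulmxN -!(mulmxA (invmx _)).
by rewrite (mulKVmx Psi_unit).
Qed.

(** Block elimination: [Gmx] is chosen so that Psi_rho [1; G] = [- Sigma S; 0]. The left side has
    rank [s rho], as Psi_rho is invertible and [1; G] has full column rank. *)
Lemma rank_Smx : \rank S = s rho.
Proof.
pose UG := castmx (Upsilon_size s rho, erefl) (col_mx 1%:M G).
have cast_adj a b b' (e : b = b') (A : 'M[C]_(a, b)) :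
    (castmx (erefl, e) A)^t* = castmx (e, erefl) (A^t*).
  by case: _ / e.
have mul_cast a b b' d (e : b = b') (A : 'M[C]_(b, a)) (D : 'M[C]_(a, d)) :
    castmx (e, erefl) A *m D = castmx (e, erefl) (A *m D) by case: _ / e.
have rank_cast a b b' (e : b = b') (A : 'M[C]_(b, a)) : \rank (castmx (e, erefl) A) = \rank A.
  by case: _ / e.
have rUG : \rank UG = s rho.
  rewrite rank_cast; apply/eqP; rewrite eqn_leq rank_leq_col /=.
  have := mxrankM_maxr (row_mx 1%:M 0) (col_mx 1%:M G).
  by rewrite mul_row_col mul1mx mul0mx addr0 mxrank1.
have : Psi PhiT T rho *m UG = castmx (Upsilon_size s rho, erefl) (col_mx (- (Sg rho *m S)) 0).
  have h1 : (Phi1 PhiT rho)^t* *m (JT *m UpsilonIG PhiT T rho) = - (Sg rho *m S).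
    by rewrite SmxE opprK mulmxA.
  have h2 : U'^t* *m (JT *m UpsilonIG PhiT T rho) = 0.
    rewrite UpsilonIGE !mulmxDr.
    have -> : U'^t* *m (JT *m (U' *m G)) = Psi PhiT T rho.+1 *m G.
      by rewrite /Psi -!mulmxA.
    by rewrite GmxE -(mulmxA _ JT) addrN.
  have -> : Psi PhiT T rho *m UG = (Upsilon PhiT rho)^t* *m (JT *m UpsilonIG PhiT T rho).
    by rewrite /Psi /UpsilonIG -!mulmxA.
  rewrite Upsilon_cons cast_adj mul_cast tr_row_mx map_col_mx mul_col_mx h1 h2.
  by [].
move/(congr1 (fun A => \rank A)); rewrite rank_cast.
rewrite (eqmxMfull UG) ?row_full_unit ?hPsi // rUG => h; apply/eqP.
rewrite eqn_leq rank_leq_row /= {1}h.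
have -> : col_mx (- (Sg rho *m S)) 0 = col_mx (- Sg rho) 0 *m S
    :> 'M[C]_(s rho + \sum_(i < m - rho.+1) s (tail_ord i), s rho).
  by rewrite mul_col_mx mul0mx mulNmx.
exact: mxrankM_maxr.
Qed.

Variables (M : 'M[C]_c) (l : nat) (Om : 'M[C]_l).
Hypotheses (Mu : M \in unitmx) (Ou : Om \in unitmx).

(* Solving the last rows of the long chains for their first blocks (by Psi_{rho+1})
   leaves Theta x - x Om = Theta_rhs r on chain rho. *)
Definition tail_rhs (r : 'M[C]_(jordan_dim s + c, l)) :=
  \mxcol_(i < m - rho.+1) (Sg (tail_ord i) *m blk r (tail_ord i) (tail_ord i)).

Definition Theta_rhs (r : 'M[C]_(jordan_dim s + c, l)) : 'M[C]_(\sum_(i < rho.+1) s rho, l) :=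
  \mxcol_(i < rho.+1) (blk r rho i - (if i == rho :> nat then
     Sg rho *m ((Phi1 PhiT rho)^t* *m JT *m (U' *m (invmx (Psi PhiT T rho.+1) *m tail_rhs r))) else 0)).

Lemma leading_solve (r : 'M[C]_(jordan_dim s + c, l)) (x : 'M[C]_(\sum_(i < rho.+1) s rho, l)) :
  Theta rho.+1 S *m x - x *m Om = Theta_rhs r ->
  exists V : 'M[C]_(jordan_dim s + c, l),
    [/\ forall i : 'I_rho.+1, blk V rho i = submxcol x i,
        forall k : 'I_m, (rho < k)%N -> blk V k 0 =
          tail_family (G *m submxcol x ord0 - invmx (Psi PhiT T rho.+1) *m tail_rhs r) k &
        G0 rho B M *m V - P2 R s c rho *m V *m Om = r].
Proof.
(* [g] holds the first blocks of the longer chains. It solves Psi_{rho+1} g = - U'^* J T Phi1_rho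
   x_0 - [tail_rhs r], which collects the last rows of these chains. *)
move=> hx; pose g := G *m submxcol x ord0 - invmx (Psi PhiT T rho.+1) *m tail_rhs r.
pose xn i : 'M[C]_(s rho, l) := if insub i is Some j then submxcol x j else 0.
have xnE (i : 'I_rho.+1) : xn i = submxcol x i by rewrite /xn valK.
pose y (k : 'I_m) i : 'M[C]_(s k, l) := if (rho < k)%N then tail_family g k else conform_mx 0 (xn i).
have yr i : y rho i = xn i by rewrite /y ltnn conform_mx_id.
have hxE i : submxcol (Theta rho.+1 S *m x) i = submxcol x i *m Om + (blk r rho i -
     (if i == rho :> nat then Sg rho *m ((Phi1 PhiT rho)^t* *m JT *m
       (U' *m (invmx (Psi PhiT T rho.+1) *m tail_rhs r))) else 0)).
  have := congr1 (fun A : 'M[C]_(\sum_(i < rho.+1) s rho, l) => submxcol A i) hx.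
  by rewrite submxcolB submxcol_mul mxcolK => <-; rewrite addrC subrK.
have x0E : xn 0%N = submxcol x ord0 by rewrite -xnE.
have PhiV : Phi *m (P0 *m of_blk y (0 : 'M[C]_(c, l))) =
    UpsilonIG PhiT T rho *m xn 0%N - U' *m (invmx (Psi PhiT T rho.+1) *m tail_rhs r).
  rewrite Phi_P0 (bigD1 rho) //= blk_of_blk // yr.
  rewrite (eq_bigl (fun k : 'I_m => (rho < k)%N)); last first.
    by move=> k; rewrite ltn_neqAle andbC eq_sym.
  under eq_bigr => k rk do rewrite blk_of_blk // /y rk.
  by rewrite tail_family_sum UpsilonIGE mulmxDl mulmxBr x0E addrA !mulmxA.
have [|||V [V1 V2 V3]] := @extend_blocks _ _ s c rho B M l Om y r _ Mu Ou erefl.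
- move=> i ir; rewrite !yr.
  have ir1 : (i < rho.+1)%N by rewrite ltnW.
  have := hxE (Ordinal ir1); rewrite (@submxcol_Theta _ _ _ _ _ _ _ (Ordinal (ir : i.+1 < rho.+1)%N)) //.
  by rewrite -!xnE /= (ltn_eqF ir) subr0.
- have h := @Phi1_JT _ rho (P0 *m of_blk y (0 : 'M[C]_(c, l))).
  have := hxE ord_max; rewrite submxcol_Theta_max eqxx -!xnE /= => h2.
  rewrite -[blk _ _ _]mul1mx -(Sg_sq rho) -mulmxA -h PhiV.
  rewrite !mulmxBr opprB (mulmxA _ (UpsilonIG _ _ _)).
  have -> : (Phi1 PhiT rho)^t* *m JT *m UpsilonIG PhiT T rho = - (Sg rho *m S).
    by rewrite SmxE opprK.
  rewrite mulNmx mulmxN opprK !(mulmxA (Sg rho)) Sg_sq mul1mx yr h2.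
  by rewrite -!(mulmxA (Sg rho)) addrC -!addrA addNr addr0.
(* U'^* J T annihilates [UpsilonIG] by the choice of G, and it sends the correction U' Psi^-1
   [tail_rhs r] to [tail_rhs r]. *)
- move=> k rk; have [i ik] := tail_ord_surj rk.
  have h := @Phi1_JT _ k (P0 *m of_blk y (0 : 'M[C]_(c, l))).
  have hU : U'^t* *m (JT *m UpsilonIG PhiT T rho) = 0.
    rewrite UpsilonIGE !mulmxDr.
    have -> : U'^t* *m (JT *m (U' *m G)) = Psi PhiT T rho.+1 *m G.
      by rewrite /Psi -!mulmxA.
    by rewrite GmxE -(mulmxA _ JT) addrN.
  have hUU : U'^t* *m (JT *m (U' *m (invmx (Psi PhiT T rho.+1) *m tail_rhs r))) = tail_rhs r.
    rewrite -[RHS](mulKVmx Psi_unit); move: (invmx _ *m _) => w.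
    by rewrite /Psi -!mulmxA.
  rewrite -[blk (B *m _) _ _]mul1mx -(Sg_sq k) -mulmxA -h PhiV.
  have -> : (Phi1 PhiT k)^t* *m JT *m (UpsilonIG PhiT T rho *m xn 0%N -
      U' *m (invmx (Psi PhiT T rho.+1) *m tail_rhs r)) = - (Sg k *m blk r k k).
    rewrite -(mulmxA _ JT) -ik -Upsilon_adj_mul !mulmxBr hUU.
    by rewrite 2!mulmxA -(mulmxA _ JT) hU mul0mx sub0r submxcolN mxcolK.
  by rewrite mulmxN opprK mulmxA Sg_sq mul1mx.
exists V; split.
- by move=> i; rewrite V1 ?yr ?xnE // -ltnS.
- by move=> k rk; rewrite V2 ?(ltnW rk) // /y rk.
- exact: V3.
Qed.

Lemma tail_rhs0 : tail_rhs 0 = 0.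
Proof.
rewrite -[RHS]mxcol0; apply/eq_mxcol => i.
by rewrite -[0 in LHS](subrr (0 : 'M[C]_(jordan_dim s + c, l))) blkB subrr mulmx0.
Qed.

Lemma leading_system (Q : 'M[C]_(s rho, l)) (F : 'M[C]_(\sum_(i < rho.+1) s rho, l)) :
  F = \mxcol_(i < rho.+1) (Q *m Om ^+ i) ->
  Theta rho.+1 S *m F = F *m Om ->
  (forall r : 'M[C]_(\sum_(i < rho.+1) s rho, l),
    exists v w, Theta rho.+1 S *m v - v *m Om - F *m w = r) ->
  exists Z0 : 'M[C]_(jordan_dim s + c, l),
    [/\ forall i : 'I_rho.+1, blk Z0 rho i = Q *m Om ^+ i,
        Phi *m (P0 *m Z0) = UpsilonIG PhiT T rho *m Q,
        G0 rho B M *m Z0 = P2 R s c rho *m Z0 *m Om &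
        forall r : 'M[C]_(jordan_dim s + c, l), exists V W,
          G0 rho B M *m V - P2 R s c rho *m V *m Om - P2 R s c rho *m Z0 *m W = r].
Proof.
move=> FE ThF solv.
have [|Z0 [Z1 Z2 Z3]] := @leading_solve 0 F.
  rewrite ThF subrr -[LHS]mxcol0; apply/eq_mxcol => i.
  rewrite tail_rhs0 !mulmx0 -[0 in RHS](subrr (0 : 'M[C]_(jordan_dim s + c, l))) blkB subrr.
  by case: ifP; rewrite subrr.
have {}Z1 (i : 'I_rho.+1) : blk Z0 rho i = Q *m Om ^+ i by rewrite Z1 FE mxcolK.
exists Z0; split=> // [||r].
- rewrite Phi_P0 (bigD1 rho) //= (Z1 ord0) expr0 mulmx1.
  rewrite (eq_bigl (fun k : 'I_m => (rho < k)%N)); last first.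
    by move=> k; rewrite ltn_neqAle andbC eq_sym.
  under eq_bigr => k rk do rewrite Z2 //.
  by rewrite tail_family_sum tail_rhs0 mulmx0 subr0 FE mxcolK expr0 mulmx1 UpsilonIGE mulmxDl mulmxA.
- by apply/eqP; rewrite -subr_eq0 Z3.
have [x [w xw]] := solv (Theta_rhs r).
have PW i : (i <= rho)%N -> blk (P2 R s c rho *m Z0 *m w) rho i = Q *m Om ^+ i *m w.
  move=> ir; rewrite -mulmxA blk_scalblk blk_mulmx (Z1 (Ordinal (ir : i < rho.+1)%N)) /=.
  by rewrite (_ : (wt rho rho i <= rho)%N) ?scale1r // /wt ltnn; lia.
(* The last rows of the longer chains have weight rho + 1 and are killed by [P2]. So w changes the
   equation on chain rho only by F w, which is the freedom that [solv] provides. *)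
have tE : tail_rhs (r + P2 R s c rho *m Z0 *m w) = tail_rhs r.
  apply/eq_mxcol => i; congr (_ *m _); rewrite blkD -mulmxA blk_scalblk.
  rewrite (_ : (wt rho _ _ <= rho)%N = false) ?scale0r ?addr0 //.
  by rewrite /wt; case: ifP => /=; lia.
have [|V [_ _ V3]] := @leading_solve (r + P2 R s c rho *m Z0 *m w) x; last first.
  by exists V, w; rewrite V3 addrK.
move/eqP: xw; rewrite subr_eq => /eqP ->; rewrite FE mxcol_mul -mxcolD.
apply/eq_mxcol => i; have ir : (i <= rho)%N by rewrite -ltnS.
rewrite tE blkD (PW i ir) addrAC; reflexivity.
Qed.

End LeadingSystem.

(** * Diagonal scalings by powers of e *)

Section Scalings.
Variables (R : realType) (m : nat) (s : 'I_m -> nat) (c : nat) (rho : 'I_m).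
Local Notation C := R[i].
Local Notation scal := (@scal R m s c rho).
Local Notation N := (jordan_dim s + c)%N.

Definition pow (e : R) (h : nat -> nat) (d : nat) : C := (e ^+ h d)%:C.

Lemma scal_mul l f g (X : 'M[C]_(N, l)) : scal f *m (scal g *m X) = scal (fun d => f d * g d) *m X.
Proof.
apply: blkP => [k i ik|]; first by rewrite !blk_scalblk scalerA.
by rewrite !dsubmx_scalblk scalerA.
Qed.

Lemma scal_eq l f g (X : 'M[C]_(N, l)) : f =1 g -> scal f *m X = scal g *m X.
Proof. by move=> fg; apply: blkP => [k i ik|]; rewrite ?blk_scalblk ?dsubmx_scalblk fg. Qed.

Lemma scal_const l z (X : 'M[C]_(N, l)) : scal (fun=> z) *m X = z *: X.
Proof.
apply: blkP => [k i ik|]; last by rewrite dsubmx_scalblk linearZ.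
rewrite blk_scalblk /blk; case: insubP => [j _ _|_]; last by rewrite scaler0.
by rewrite linearZ; apply/matrixP => x y; rewrite !mxE.
Qed.

Lemma A0_scal l f M (X : 'M[C]_(N, l)) :
  A0 s M *m (scal f *m X) = scal (fun d => f (minn d.+1 rho.+1)) *m (A0 s M *m X).
Proof.
apply: blkP => [k i ik|]; last first.
  by rewrite dsubmx_diag !dsubmx_scalblk dsubmx_diag -scalemxAr (minn_idPr (leqnSn _)).
rewrite blk_nilblock // !blk_scalblk blk_nilblock //.
have [ki|ki] := ltnP i k; first by rewrite wtS.
by rewrite blk_default ?scaler0 // ltnS.
Qed.

Lemma scal_bnd0 h : bnd 0 (fun e => scal (pow e h)).
Proof.
exists ((N * N)%:R * 1); rewrite ?mulr1 //; near=> e; rewrite expr0 mulr1 -[leRHS]mulr1.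
have /andP[e0 e1] : 0 < e < 1 by near: e; exact: near0_unit_interval.
have pb d : Normc.normc (pow e h d) <= 1.
  by rewrite normc_real ger0_norm ?exprn_ge0 ?(ltW e0) // exprn_ile1 // ltW.
by apply: nrm_scalblk => // [k i|]; exact: pb.
Unshelve. all: by end_near. Qed.

(** Coefficients with exponent 0 are already equal to their limit; the others are at most e when e <
    1. *)
Lemma scal_bnd1 h : bnd 1 (fun e => scal (pow e h) - scal (fun d => (h d == 0)%N%:R)).
Proof.
exists (N * N)%:R => //; near=> e; rewrite expr1.
have /andP[e0 e1] : 0 < e < 1 by near: e; exact: near0_unit_interval.
have -> : scal (pow e h) - scal (fun d => (h d == 0)%N%:R) =
    scal (fun d => pow e h d - (h d == 0)%N%:R).
  rewrite -[LHS]mulmx1 -[RHS]mulmx1 mulmxBl; apply: blkP => [k i ik|].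
    by rewrite blkB !blk_scalblk scalerBl.
  by rewrite linearB /= !dsubmx_scalblk scalerBl.
have pb d : Normc.normc (pow e h d - (h d == 0)%N%:R) <= e.
  rewrite /pow; case: (h d) => [|j].
    by rewrite expr0 eqxx subrr Normc.normc0 ltW.
  rewrite subr0 normc_real ger0_norm ?exprn_ge0 ?(ltW e0) //.
  by rewrite exprS ler_piMr ?(ltW e0) // exprn_ile1 // ltW.
by apply: nrm_scalblk => //; exact: ltW.
Unshelve. all: by end_near. Qed.

End Scalings.

Lemma submxcol_antidiag (R : realType) k d l (A : 'M[R[i]]_d) (x : 'M[R[i]]_(\sum_(i < k) d, l)) i :
  submxcol (antidiag k A *m x) i = A *m submxcol x (rev_ord i).
Proof.
rewrite -{1}[x]submxcolK mul_mxblock_mxrow mxcolK (bigD1 (rev_ord i)) //= big1.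
  by rewrite addr0 -addnS subnSK // subnKC ?eqxx // ltnW.
move=> j ji; rewrite ifN ?mul0mx //; apply: contraNneq ji => ijk.
by apply/eqP/val_inj; rewrite /= -(addKn i.+1 j) addSn ijk.
Qed.

Lemma antidiag_sq (R : realType) k d (A : 'M[R[i]]_d) :
  A *m A = 1%:M -> antidiag k A *m antidiag k A = 1%:M.
Proof.
move=> AA; rewrite -[LHS]mulmx1 -mulmxA; apply/mxcolP => i.
by rewrite !submxcol_antidiag rev_ordK mulmxA AA mul1mx.
Qed.

Lemma canonical_sq (R : realType) l (D : 'M[R[i]]_l) : canonical_sign_form D -> D *m D = 1%:M.
Proof.
move=> [q [d [A [e [hA ->]]]]]; case: _ / e; rewrite castmx_id.
have AA i : A i *m A i = 1%:M.
  case: (hA i) => [r|k a b _]; last by apply: antidiag_sq; exact: signature_sq.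
  by rewrite mulmx_block !mulmx0 !mul0mx !mulmx1 !addr0 !add0r -scalar_mx_block.
rewrite mul_mxblock_mxdiag -(mxdiagZ 1); apply/mxblockP => i j.
rewrite !mxblockK; case: eqVneq => [ij|_]; last by rewrite mul0mx.
by case: _ / ij; rewrite !conform_mx_id AA.
Qed.

(** * From the variable e back to x = e^p *)

Section RealPowers.
Variable R : realType.
Local Notation C := R[i].

Lemma mx_norm_nrm a b (A : 'M[C]_(a, b)) : `|A| <= (nrm A)%:C.
Proof.
rewrite -[ `|A| ]/(mx_norm A).
have [->|/mx_norm_neq0[[i j] ->]] := eqVneq (mx_norm A) 0; first by rewrite lecR nrm_ge0.
by rewrite /= -[ `|_| ]/((Normc.normc (A i j))%:C) lecR le_nrm_entry.
Qed.

Lemma near_root (P : R -> Prop) p :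
  (\forall e \near (0 : R)^'+, P e) -> \forall x \near (0 : R)^'+, P (x `^ p.+1%:R^-1).
Proof.
move=> hP; have p0 : 0 < p.+1%:R^-1 :> R by rewrite invr_gt0.
have /= cv := powR_cvg0 p0.
have : \forall e \near (0 : R), 0 < e -> P e by [].
move=> /cv h; near=> x; have : 0 < x `^ p.+1%:R^-1 -> P (x `^ p.+1%:R^-1) by near: x; exact: h.
by apply; rewrite powR_gt0.
Unshelve. all: by end_near. Qed.

Lemma powR_root p j (x : R) : 0 < x -> x `^ (j%:R / p.+1%:R) = (x `^ p.+1%:R^-1) ^+ j.
Proof. by move=> x0; rewrite mulrC powRrM powR_mulrn // powR_ge0. Qed.

Lemma mxO_bnd p j a b (f : R -> 'M[C]_(a, b)) (g : R -> R) :
  bnd j f -> (forall x, 0 < x -> g x = (x `^ p.+1%:R^-1) ^+ j) ->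
  mxO (fun x => f (x `^ p.+1%:R^-1)) g.
Proof.
move=> [K K0 hf] gE; rewrite /mxO; apply/eqO_exP; exists (K + 1)%:C.
  by rewrite ltcR ltr_wpDl.
near=> x; have x0 : 0 < x by [].
have -> : `|(g x)%:C : C^o| = (g x)%:C.
  by rewrite -[LHS]/((Normc.normc (g x)%:C)%:C) normc_real ger0_norm // gE // exprn_ge0 ?powR_ge0.
apply: le_trans (mx_norm_nrm _) _; rewrite -rmorphM lecR gE //.
apply: le_trans (_ : _ <= K * (x `^ p.+1%:R^-1) ^+ j) _.
  by near: x; exact: (near_root p hf).
by rewrite ler_wpM2r ?exprn_ge0 ?powR_ge0 // lerDl.
Unshelve. all: by end_near. Qed.

End RealPowers.

(** * The perturbed invariant subspace and its Gram matrix *)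

Section Perturbation.
Variables (R : realType) (m : nat) (s t : 'I_m -> nat) (c : nat) (rho : 'I_m).
Local Notation C := R[i].
Local Notation N := (jordan_dim s + c)%N.
Local Notation D e := (@scal R m s c rho (pow e id)).

(** The equation is solved in the form (A0 - E1 B D) Z = E2 Z Om', where all powers of e are
    nonnegative, and then multiplied by diag(e^w). Since w + h1 = p and w + h2 = d + 1, this
    restores the factors e^p and e. *)
Lemma scaled_pencil_perturbation l (B : 'M[C]_N) (M : 'M[C]_c) (Om : 'M[C]_l) (Z0 : 'M[C]_(N, l)) :
  G0 rho B M *m Z0 = P2 R s c rho *m Z0 *m Om ->
  (forall r : 'M[C]_(N, l), exists V W,
      G0 rho B M *m V - P2 R s c rho *m V *m Om - P2 R s c rho *m Z0 *m W = r) ->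
  exists (Z : R -> 'M[C]_(N, l)) (Om' : R -> 'M[C]_l),
    [/\ bnd 1 (fun e => Z e - Z0), bnd 1 (fun e => Om' e - Om) &
      \forall e \near (0 : R)^'+,
        A0 s M *m (D e *m Z e) - (e ^+ rho.+1)%:C *: (B *m (D e *m Z e)) =
        e%:C *: (D e *m Z e *m Om' e)].
Proof.
move=> hZ0 surj.
pose w d := minn d.+1 rho.+1.
pose h1 d := (rho.+1 - w d)%N; pose h2 d := (d.+1 - w d)%N.
pose E1 e := @scal R m s c rho (pow e h1); pose E2 e := @scal R m s c rho (pow e h2).
have P0E : P0 R s c rho = @scal R m s c rho (fun d => (d == 0)%N%:R) by [].
have P1E : P1 R s c rho = @scal R m s c rho (fun d => (h1 d == 0)%N%:R).
  congr scal; apply: funext => d; congr (nat_of_bool _)%:R; rewrite /h1 /w; lia.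
have P2E : P2 R s c rho = @scal R m s c rho (fun d => (h2 d == 0)%N%:R).
  congr scal; apply: funext => d; congr (nat_of_bool _)%:R; rewrite /h2 /w; lia.
have [||Z [Om' [Z1 O1 hZ]]] := @pencil_perturbation R N l
    (fun e => A0 s M - E1 e *m B *m D e) E2 _ _ Om Z0 _ _ hZ0 surj.
- have b0 := @scal_bnd0 R m s c rho h1.
  have b1 := @scal_bnd1 R m s c rho h1; have b2 := @scal_bnd1 R m s c rho id.
  rewrite -P1E in b1; rewrite -P0E in b2.
  apply: (@bnd_near _ _ _ _ (fun e => - ((E1 e *m B) *m (D e - P0 R s c rho)
      + (E1 e - P1 R s c rho) *m (B *m P0 R s c rho)))).
    near=> e; rewrite /G0; move: (E1 e) (P1 _ _ _ _) (D e) (P0 _ _ _ _) (A0 _ _) => x y z p a.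
    rewrite mulmxBr mulmxBl !mulmxA subrKA opprB [in RHS]opprB.
    by rewrite [in RHS]addrC subrKA.
  apply: bndN; apply: bndD; last exact: bndMr.
  by apply: (@bndM _ 0 1) => //; exact: bndMr.
- by rewrite P2E; exact: scal_bnd1.
exists Z, Om'; split=> //; near=> e.
have : (A0 s M - E1 e *m B *m D e) *m Z e = E2 e *m Z e *m Om' e by near: e.
move/(congr1 (fun X => @scal R m s c rho (pow e w) *m X)).
rewrite mulmxBl mulmxBr -!mulmxA !scal_mul => h.
have powM (f g : nat -> nat) d : pow e f d * pow e g d = (e ^+ (f d + g d))%:C.
  by rewrite -rmorphM -exprD.
rewrite A0_scal -(@scal_const R m s c rho).
rewrite -(@scal_const R m s c rho _ e%:C) scal_mul.
rewrite (@scal_eq _ _ _ _ _ _ (fun=> (e ^+ rho.+1)%:C)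
  (fun d => pow e w d * pow e h1 d)); last first.
  by move=> d; rewrite powM /h1 subnKC // geq_minr.
rewrite [RHS](@scal_eq _ _ _ _ _ _ _ (fun d => pow e w d * pow e h2 d)); first exact: h.
by move=> d; rewrite powM /h2 subnKC ?geq_minl // -rmorphM -exprS.
Unshelve. all: by end_near. Qed.

Lemma bnd_sum k a b (I : finType) (P : pred I) (f : I -> R -> 'M[C]_(a, b)) :
  (forall i, P i -> bnd k (f i)) -> bnd k (fun e => \sum_(i | P i) f i e).
Proof.
move=> hf; rewrite /index_enum; elim: (locked_with _ _) => [|i r IH].
  by exists 0 => //; near=> e; rewrite big_nil nrm0 mul0r.
case Pi : (P i).
  by apply: (bnd_near _ (bndD (hf i Pi) IH)); near=> e; rewrite big_cons Pi.
by apply: (bnd_near _ IH); near=> e; rewrite big_cons Pi.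
Unshelve. all: by end_near. Qed.

(** The Gram matrix pairs block i with block k - i, so its terms carry the sum of these weights.
    That sum is rho on chain rho and larger on every other chain. *)
Lemma wt_sum_ge (k : 'I_m) i : (i <= k)%N -> (rho <= wt rho k i + wt rho k (k - i))%N.
Proof. by rewrite /wt; case: ifP => ? ?; lia. Qed.

Lemma wt_sum_gt (k : 'I_m) i : (i <= k)%N -> k != rho ->
  (rho < wt rho k i + wt rho k (k - i))%N.
Proof. by rewrite -val_eqE /= /wt; case: ifP => ? ? ?; lia. Qed.

Lemma scaled_gram l (DC : 'M[C]_c) (Z : R -> 'M[C]_(N, l)) (Z0 : 'M[C]_(N, l)) :
  bnd 1 (fun e => Z e - Z0) ->
  exists2 X : R -> 'M[C]_l,
    bnd 1 (fun e => X e - \sum_(i < rho.+1) (blk Z0 rho i)^t* *m (Sigma R s t rho *m blk Z0 rho (rho - i))) &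
    forall e, (D e *m Z e)^t* *m (block_mx (\mxdiag_j Gamma R s t j) 0 0 DC *m (D e *m Z e)) =
      (e ^+ rho)%:C *: X e.
Proof.
move=> hZ; have Z00 : bnd 0 Z.
  apply: (@bnd_near _ _ _ _ (fun e => Z e - Z0 + Z0)); first by near=> e; rewrite subrK.
  exact: bndD (bndW _ hZ) (bnd_const _).
(* Exponent left after e^rho is factored out; by [wt_sum_ge] the truncated subtraction is exact. *)
pose q (k : 'I_m) i := (wt rho k i + wt rho k (k - i) - rho)%N.
pose term (k : 'I_m) (i : nat) e := (blk (Z e) k i)^t* *m (Sigma R s t k *m blk (Z e) k (k - i)).
exists (fun e => \sum_(k < m) \sum_(i < k.+1) (e ^+ q k i)%:C *: term k i e
   + (e ^+ (rho.+1 + rho.+1 - rho))%:C *: ((dsubmx (Z e))^t* *m (DC *m dsubmx (Z e)))).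
  have tb k i : bnd 0 (term k i).
    by apply: (@bndM _ 0 0); [exact: bnd_adj (bnd_blk _ _ Z00)|exact: bndMl (bnd_blk _ _ Z00)].
  apply: (@bnd_near _ _ _ _ (fun e => \sum_(i < rho.+1) (term rho i e -
      (blk Z0 rho i)^t* *m (Sigma R s t rho *m blk Z0 rho (rho - i)))
    + (\sum_(k < m | k != rho) \sum_(i < k.+1) (e ^+ q k i)%:C *: term k i e
    + (e ^+ (rho.+1 + rho.+1 - rho))%:C *: ((dsubmx (Z e))^t* *m (DC *m dsubmx (Z e)))))).
    near=> e; rewrite sumrB [in RHS](bigD1 rho) //=.
    have -> : \sum_(i < rho.+1) (e ^+ q rho i)%:C *: term rho i e = \sum_(i < rho.+1) term rho i e.
      apply: eq_bigr => i _; rewrite (_ : q rho i = 0%N) ?expr0 ?scale1r //.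
      by have := ltn_ord i; rewrite /q /wt ltnn; lia.
    by rewrite addrAC !addrA.
  apply: bndD; [|apply: bndD].
  - apply: bnd_sum => i _.
    apply: (@bnd_near _ _ _ _ (fun e => (blk (Z e - Z0) rho i)^t* *m (Sigma R s t rho *m blk (Z e) rho (rho - i))
      + (blk Z0 rho i)^t* *m (Sigma R s t rho *m blk (Z e - Z0) rho (rho - i)))).
      near=> e; rewrite !blkB ctmxB mulmxBl !mulmxBr addrA subrK; reflexivity.
    apply: bndD; last by do 2 apply: bndMl; exact: bnd_blk.
    by apply: (@bndM _ 1 0); [exact: bnd_adj (bnd_blk _ _ hZ)|exact: bndMl (bnd_blk _ _ Z00)].
  - apply: bnd_sum => k kr; apply: bnd_sum => i _.
    apply: (@bndW _ (q k i + 0)); last exact: bndX.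
    by rewrite addn0 subn_gt0 wt_sum_gt // -ltnS.
  - apply: (@bndW _ (rho.+1 + rho.+1 - rho + 0)); first by lia.
    by apply: bndX; apply: (@bndM _ 0 0); [exact: bnd_adj (bnd_dsubmx Z00)|exact: bndMl (bnd_dsubmx Z00)].
move=> e; rewrite adj_mul_blk scalerDr scaler_sumr; congr (_ + _).
  apply: eq_bigr => k _; rewrite scaler_sumr; apply: eq_bigr => i _.
  have ik : (i <= k)%N by rewrite -ltnS.
  have DE j : blk (D e *m Z e) k j = (e ^+ wt rho k j)%:C *: blk (Z e) k j by exact: blk_scalblk.
  rewrite (blk_antidiag (Sigma R s t) DC (D e *m Z e) ik) !DE ctmxZ.
  rewrite -!scalemxAl -!scalemxAr !scalerA; congr (_ *: _).
  rewrite -[Num.conj _]/(conjc _) conjc_real -!rmorphM -!exprD; congr (e ^+ _)%:C.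
  by rewrite /q subnKC //; exact: wt_sum_ge.
have DE : dsubmx (D e *m Z e) = (e ^+ rho.+1)%:C *: dsubmx (Z e) by exact: dsubmx_scalblk.
rewrite DE dsubmx_diag DE ctmxZ -!scalemxAl -!scalemxAr !scalerA; congr (_ *: _).
rewrite -[Num.conj _]/(conjc _) conjc_real -!rmorphM -!exprD; congr (e ^+ _)%:C.
by lia.
Unshelve. all: by end_near. Qed.

End Perturbation.

(** * Passage to the basis Phi, and assembly of the result *)

Lemma castmx_inverse (F : fieldType) a b (e : b = a) (A : 'M[F]_(a, b)) :
  castmx (erefl, e) A \in unitmx -> exists A', A *m A' = 1%:M /\ A' *m A = 1%:M.
Proof.
case: a / e A => A; rewrite castmx_id => Au; exists (invmx A).
by rewrite mulmxV // mulVmx.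
Qed.

Lemma ctmxK (R : realType) a b (A : 'M[R[i]]_(a, b)) : A^t*^t* = A.
Proof. exact: trmxCK. Qed.

Lemma Jmx_skew (R : realType) n : (Jmx R n)^t* = - Jmx R n.
Proof.
rewrite /Jmx tr_block_mx map_block_mx opp_block_mx.
by rewrite !trmx0 !map_mx0 !oppr0 opprK linearN /= map_mxN trmx1 map_mx1.
Qed.

Lemma adj_mul_submxcol (R : realType) k (d : 'I_k -> nat) l (A B : 'M[R[i]]_(\sum_i d i, l)) :
  A^t* *m B = \sum_i (submxcol A i)^t* *m submxcol B i.
Proof.
have {1}-> : A^t* = \mxrow_i (submxcol A i)^t*.
  by rewrite -{1}[A]submxcolK; apply/matrixP => x y; rewrite !mxE.
by rewrite -{1}[B]submxcolK mul_mxrow_mxcol.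
Qed.

(** The exponent is the weight [wt], except at the first block of a longer chain: there the weight
    is 0, but the leading term is split off and the error is of order e. *)
Lemma delta_root (R : realType) rho k i (x : R) : (i <= k)%N -> k != rho -> 0 < x ->
  delta rho.+1 k.+1 i.+1 x = (x `^ rho.+1%:R^-1) ^+
    (if (k < rho)%N then rho - k + i else if i == 0%N then 1 else minn i rho.+1)%N.
Proof.
move=> ik kr x0; rewrite /delta !ltnS !eqSS (negbTE kr).
case: ifP => [kr'|_]; last first.
  by case: (i) => [|j]; rewrite -powR_root // mul1r.
rewrite -powR_root //; congr (x `^ _).
have a : (k.+2 - i.+1 <= rho.+1)%N by lia.
have -> : (rho - k + i = rho.+1 - (k.+2 - i.+1))%N by lia.
by rewrite (natrB _ a) mulrBl divff // pnatr_eq0.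
Qed.

Section Assembly.
Variables (R : realType) (n : nat) (H T : 'M[R[i]]_(n + n)) (alpha : R).
Variables (m : nat) (s t : 'I_m -> nat) (c : nat).
Variables (PhiT : 'M[R[i]]_(n + n, jordan_dim s)) (PhiC : 'M[R[i]]_(n + n, c)).
Variables (HC DeltaC : 'M[R[i]]_c).
Local Notation C := R[i].
Local Notation Phi := (row_mx PhiT PhiC).
Local Notation Delta := (block_mx (\mxdiag_j Gamma R s t j) 0 0 DeltaC).
Local Notation M := (- 'i%C *: HC - alpha%:C%:M : 'M[C]_c).
Hypothesis hHPhi : H *m Phi = Phi *m block_mx ('i%C *: (alpha%:C%:M + Nmx R s)) 0 0 HC.
Hypothesis hJPhi : Phi^t* *m Jmx R n *m Phi = 'i%C *: Delta.

Lemma Delta_hermitian : Delta^t* = Delta.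
Proof.
have := congr1 (fun A => A^t*) hJPhi; rewrite /= !ctmxM ctmxK Jmx_skew mulNmx mulmxN mulmxA hJPhi ctmxZ.
move: Delta => X; have -> : Num.conj ('i%C : C) = - 'i%C by apply/eqP; rewrite eq_complex /= oppr0 !eqxx.
rewrite scaleNr => /oppr_inj.
move/(congr1 (fun A => (- 'i%C) *: A)); rewrite !scalerA mulNr -expr2 sqr_i opprK !scale1r.
by move=> <-.
Qed.

Lemma M_unit : 'i%C * alpha%:C \notin spectrum HC -> M \in unitmx.
Proof.
move=> /spectrum_inv_unit h.
have -> : M = - 'i%C *: (HC - ('i%C * alpha%:C)%:M).
  by rewrite scalerBr scale_scalar_mx mulrA mulNr -expr2 sqr_i opprK mul1r.
rewrite unitmxZ // unitfE oppr_eq0; apply/negP => /eqP i0.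
by have := sqr_i R; rewrite i0 expr0n /= => /eqP; rewrite eq_sym oppr_eq0 oner_eq0.
Qed.

Lemma H_Phi l (Y : 'M[C]_(jordan_dim s + c, l)) :
  H *m (Phi *m Y) = 'i%C *: (Phi *m (alpha%:C *: Y + A0 s M *m Y)).
Proof.
rewrite mulmxA hHPhi -mulmxA scalemxAr; congr (_ *m _).
rewrite /A0 -(mul_scalar_mx alpha%:C) -mulmxDl scalemxAl; congr (_ *m _).
rewrite scalar_mx_block add_block_mx scale_block_mx !addr0 !scaler0; congr block_mx.
rewrite addrC subrK scalerA mulrN -expr2 sqr_i opprK; exact/esym/scale1r.
Qed.

Lemma perturbed_invariance B l (Y : 'M[C]_(jordan_dim s + c, l)) (O : 'M[C]_l) z e :
  T *m Phi = - 'i%C *: (Phi *m B) ->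
  A0 s M *m Y - z *: (B *m Y) = e *: (Y *m O) ->
  (H + z *: T) *m (Phi *m Y) = Phi *m Y *m ('i%C *: (alpha%:C%:M + e *: O)).
Proof.
move=> hB hY; rewrite mulmxDl H_Phi -scalemxAl.
have -> : z *: (T *m (Phi *m Y)) = 'i%C *: (Phi *m (- (z *: (B *m Y)))).
  rewrite (mulmxA T) hB mulmxN -scalemxAl -scalemxAr scalerN !scalerA.
  by rewrite mulrN scaleNr (mulrC z) -mulmxA.
rewrite -scalerDr -mulmxDr -addrA hY.
rewrite -scalemxAr -mulmxA; congr (_ *: (_ *m _)).
by rewrite mulmxDr mul_mx_scalar scalemxAr.
Qed.

Lemma gram_Phi l (Y : 'M[C]_(jordan_dim s + c, l)) :
  (Phi *m Y)^t* *m Jmx R n *m (Phi *m Y) = 'i%C *: (Y^t* *m (Delta *m Y)).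
Proof.
have h : Phi^t* *m (Jmx R n *m (Phi *m Y)) = 'i%C *: (Delta *m Y).
  by rewrite !mulmxA hJPhi scalemxAl.
by rewrite ctmxM -!mulmxA h -scalemxAr.
Qed.

End Assembly.

Lemma bnd1M (R : realType) a b d (f : R -> 'M[R[i]]_(a, b)) (g : R -> 'M[R[i]]_(b, d)) A B :
  bnd 1 (fun e => f e - A) -> bnd 1 (fun e => g e - B) ->
  bnd 1 (fun e => f e *m g e - A *m B).
Proof.
move=> hf hg.
apply: (@bnd_near _ _ _ _ (fun e => (f e - A) *m (g e - B) + (f e - A) *m B + A *m (g e - B))).
  by near=> e; rewrite -mulmxDr subrK mulmxBl mulmxBr addrA subrK.
apply: bndD; last exact: bndMl.
by apply: bndD; [apply: (@bndW _ 2) => //; exact: bndM hf hg|exact: bndMr].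
Unshelve. all: by end_near. Qed.

Lemma expmxZ (R : comPzRingType) l z (A : 'M[R]_l) k : (z *: A) ^+ k = z ^+ k *: A ^+ k.
Proof.
elim: k => [|k IH]; first by rewrite !expr0 scale1r.
by rewrite !exprS IH -!mulmxE -scalemxAl -scalemxAr scalerA.
Qed.


(* F Om^(k+1) = diag(S) F because S Q = Q Om^(k+1). *)
Lemma Omega_unit (R : realType) d k l (S : 'M[R[i]]_d) (Q : 'M[R[i]]_(d, l)) (Om : 'M[R[i]]_l)
    (F : 'M[R[i]]_(\sum_(i < k.+1) d, l)) :
  S \in unitmx -> \rank F = l -> F = \mxcol_(i < k.+1) (Q *m Om ^+ i) ->
  S *m Q = Q *m Om ^+ k.+1 -> Om \in unitmx.
Proof.
move=> Su Fr FE SQ; rewrite -row_free_unit /row_free eqn_leq rank_leq_row /=.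
have FS : F = (\mxdiag_(i < k.+1) invmx S) *m F *m Om ^+ k *m Om.
  rewrite {2}FE mul_mxdiag_mxcol !mxcol_mul {1}FE; apply/eq_mxcol => i.
  rewrite -!mulmxA !mulmxE -exprSr -exprD addnC exprD -!mulmxE !mulmxA -(mulmxA (invmx S)) -SQ.
  by rewrite mulKmx.
by rewrite -{1}Fr {1}FS; exact: mxrankM_maxr.
Qed.
Theorem theorem15 (R : realType) (n : nat) (H T : 'M[R[i]]_(n + n))
  (hH : hamiltonian H) (hT : hamiltonian T) (alpha : R)
  (m : nat) (hm : (1 <= m)%N) (s t : 'I_m -> nat)
  (hs : forall j : 'I_m, j.+1 = m -> (0 < s j)%N)
  (ht : forall j : 'I_m, (t j <= s j)%N)
  (c : nat) (hc : (jordan_dim s + c)%N = (n + n)%N)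
  (PhiT : 'M[R[i]]_(n + n, jordan_dim s)) (PhiC : 'M[R[i]]_(n + n, c))
  (HC DeltaC : 'M[R[i]]_c)
  (hPhi : castmx (erefl, hc) (row_mx PhiT PhiC) \in unitmx)
  (hHPhi : H *m row_mx PhiT PhiC =
    row_mx PhiT PhiC *m
      block_mx ('i%C *: (alpha%:C%:M + Nmx R s)) 0 0 HC)
  (hJPhi : (row_mx PhiT PhiC)^t* *m Jmx R n *m row_mx PhiT PhiC =
    'i%C *: block_mx (\mxdiag_j Gamma R s t j) 0 0 DeltaC)
  (hHC : 'i%C * alpha%:C \notin spectrum HC)
  (hPsi : forall k : 'I_m, Psi PhiT T k \in unitmx)
  (rho : 'I_m) (l : nat)
  (F : 'M[R[i]]_(\sum_(i < rho.+1) s rho, l))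
  (Omega DeltaO : 'M[R[i]]_l) (Q : 'M[R[i]]_(s rho, l))
  (hFrank : \rank F = l)
  (hFOmega : Theta rho.+1 (Smx t PhiT T rho) *m F = F *m Omega)
  (hFGamma : F^t* *m Gamma R s t rho *m F = DeltaO)
  (hFQ : F = \mxcol_(i < rho.+1) (Q *m Omega ^+ i))
  (hSQ : Smx t PhiT T rho *m Q = Q *m Omega ^+ rho.+1)
  (hDherm : DeltaO = DeltaO^t*)
  (hDcanon : canonical_sign_form DeltaO)
  (hsub : (spectrum Omega `<=` spectrum (Theta rho.+1 (Smx t PhiT T rho)))%mset)
  (hconj : forall z : R[i], spectrum Omega z^* = spectrum Omega z)
  (hdisj : (spectrum Omega `&`
     (spectrum (Theta rho.+1 (Smx t PhiT T rho)) `\` spectrum Omega))%mset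
     = mset0) :
  exists (PhiO : R -> 'M[R[i]]_(n + n, l))
         (L : forall k : 'I_m, R -> 'M[R[i]]_(\sum_(i < k.+1) s k, l))
         (OmegaO : R -> 'M[R[i]]_l),
    [/\ mxO (fun x => PhiO x -
               (UpsilonIG PhiT T rho *m Q + \sum_k Phi PhiT k *m L k x)) id,
        forall k : 'I_m, k != rho -> blockO rho.+1 (L k),
        blockO rho.+1 (fun x => L rho x -
          \mxcol_(i < rho.+1)
            (if i == 0%N :> nat then 0
             else Q *m ((x `^ (rho.+1%:R^-1))%:C *: Omega) ^+ i)),
        mxO (fun x => OmegaO x - Omega) (fun x => x `^ (rho.+1%:R^-1)) &
        \forall x \near (0 : R)^'+,
          (H + x%:C *: T) *m PhiO x =
            PhiO x *m ('i%C *: (alpha%:C%:M +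
                              (x `^ (rho.+1%:R^-1))%:C *: OmegaO x)) /\
          (PhiO x)^t* *m Jmx R n *m PhiO x =
            (x `^ (1 - rho.+1%:R^-1))%:C *: ('i%C *: DeltaO)].
Proof.
(* The sizes [n + n] and [jordan_dim s + c] are only provably equal, so the inverse of Phi is kept
   as a rectangular matrix. *)
have [Pi [PiR PiL]] := castmx_inverse hPhi.
pose B := 'i%C *: (Pi *m T *m row_mx PhiT PhiC).
have hB : T *m row_mx PhiT PhiC = - 'i%C *: (row_mx PhiT PhiC *m B).
  by rewrite -scalemxAr scalerA mulNr -expr2 sqr_i opprK scale1r !mulmxA PiR mul1mx.
clearbody B; have Mu := M_unit hHC.
have Su : Smx t PhiT T rho \in unitmx.
  by rewrite -row_free_unit /row_free (rank_Smx t hPsi rho).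
have Ou := Omega_unit Su hFrank hFQ hSQ.
have solv := spectrum_disjoint_solve hFrank hFOmega hdisj.
have [Z0 [Z0Q Z0Phi Z0E Z0surj]] := leading_system hJPhi hPsi hB Mu Ou hFQ hFOmega solv.
have [Z [Om' [Z1 O1 hZ]]] := scaled_pencil_perturbation Z0E Z0surj.
have [X X1 hX] := scaled_gram t rho DeltaC Z1.
pose D e := @scal R m s c rho (pow e id).
have DeltaE : \sum_(i < rho.+1) (blk Z0 rho i)^t* *m (Sigma R s t rho *m blk Z0 rho (rho - i)) = DeltaO.
  rewrite -hFGamma -mulmxA adj_mul_submxcol; apply: eq_bigr => i _.
  rewrite submxcol_antidiag hFQ !mxcolK Z0Q; congr (_ *m (_ *m _)).
  by rewrite -(Z0Q (rev_ord i)) /= subSS.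
rewrite DeltaE in X1.
have DD := canonical_sq hDcanon.
pose Delta := block_mx (\mxdiag_j Gamma R s t j) 0 0 DeltaC.
have hherm l' (Y : 'M[R[i]]_(jordan_dim s + c, l')) :
    (Y^t* *m (Delta *m Y))^t* = Y^t* *m (Delta *m Y).
  by rewrite !ctmxM ctmxK (Delta_hermitian hJPhi) mulmxA.
(* e^rho X is the Gram matrix of [D e *m Z e] for the Hermitian matrix Delta, and e^rho is real and
   nonzero. *)
have Xh : \forall e \near (0 : R)^'+, (X e)^t* = X e.
  near=> e; have e0 : 0 < e by [].
  have := hherm _ (D e *m Z e); rewrite hX ctmxZ -[Num.conj _]/(conjc _) conjc_real.
  move=> /(congr1 (fun A => (e ^+ rho)%:C^-1 *: A)).
  by rewrite !scalerA mulVf ?scale1r // (inj_eq (@complexI _)) expf_neq0 // gt_eqF.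
have [Qm Q1 hQ] := orthonormalize hDherm DD X1 Xh.
pose Zt e := Z e *m Qm e.
have Zt1 : bnd 1 (fun e => Zt e - Z0).
  apply: (@bnd_near _ _ _ _ (fun e => (Z e - Z0) *m (Qm e - 1%:M) + (Z e - Z0) + Z0 *m (Qm e - 1%:M))).
    by near=> e; rewrite /Zt mulmxBr mulmx1 subrK mulmxBl mulmxBr mulmx1 addrA subrK.
  apply: bndD; [apply: bndD => //|exact: bndMl].
  by apply: (@bndW _ 2) => //; exact: bndM Z1 Q1.
have Zt0 : bnd 0 Zt.
  apply: (@bnd_near _ _ _ _ (fun e => Zt e - Z0 + Z0)); first by near=> e; rewrite subrK.
  exact: bndD (bndW _ Zt1) (bnd_const _).
(* By [Z0Phi] the subtracted part is mapped by Phi to the leading term [UpsilonIG *m Q]. *)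
pose err e := D e *m Zt e - P0 R s c rho *m Z0.
have errE (k : 'I_m) i e : blk (err e) k i =
    (e ^+ wt rho k i)%:C *: blk (Zt e) k i - (wt rho k i == 0)%N%:R *: blk Z0 k i.
  by rewrite blkB; congr (_ - _); exact: blk_scalblk.
(* At weight 0 the power of e gives nothing, and the order 1 comes from Zt - Z0. *)
have err_bnd (k : 'I_m) i : bnd (if wt rho k i is w.+1 then w.+1 else 1) (fun e => blk (err e) k i).
  case wE : (wt rho k i) => [|w].
    apply: (bnd_near _ (bnd_blk k i Zt1)); near=> e.
    by rewrite errE wE expr0 eqxx !scale1r blkB.
  apply: (@bnd_near _ _ _ _ (fun e => (e ^+ w.+1)%:C *: blk (Zt e) k i)).
    by near=> e; rewrite errE wE (_ : (w.+1 == 0)%N = false) ?scale0r ?subr0.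
  by rewrite -[X in bnd X _]addn0; apply: bndX; exact: bnd_blk.
pose PhiO e := row_mx PhiT PhiC *m (D e *m Zt e).
pose L (k : 'I_m) e : 'M[R[i]]_(\sum_(i < k.+1) s k, l) := \mxcol_(i < k.+1) blk (err e) k i.
(* Qm^* X Qm = DeltaO and DeltaO^2 = 1 make DeltaO Qm^* X the inverse of Qm, so this is Om'
   conjugated by Qm. *)
pose OmO e := DeltaO *m (Qm e)^t* *m X e *m Om' e *m Qm e.
pose root x : R := x `^ (rho.+1%:R^-1).
exists (fun x => PhiO (root x)), (fun k x => L k (root x)), (fun x => OmO (root x)).
have wtrho (i : 'I_rho.+1) : wt rho rho i = i.
  by have := ltn_ord i; rewrite /wt ltnn; lia.
split.
(* The O(t) term is exactly the complementary component, whose weight is p. *)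
- have -> : (fun x => PhiO (root x) - (UpsilonIG PhiT T rho *m Q + \sum_k Phi PhiT k *m L k (root x))) =
      (fun x => PhiC *m dsubmx (err (root x))).
    apply: funext => x; rewrite /PhiO -Z0Phi.
    rewrite -[D (root x) *m _](subrK (P0 R s c rho *m Z0)) -/(err (root x)) mulmxDr.
    rewrite [X in X - _]addrC opprD addrACA subrr add0r row_mul_blk.
    by rewrite addrAC subrr add0r.
  apply: (@mxO_bnd _ rho rho.+1 _ _ (fun e => PhiC *m dsubmx (err e))).
    apply: bndMl; apply: (@bnd_near _ _ _ _ (fun e => (e ^+ rho.+1)%:C *: dsubmx (Zt e))).
      near=> e; rewrite /err linearB /= (dsubmx_scalblk _ _ _ Z0) scale0r subr0.
      exact/esym/dsubmx_scalblk.
    by rewrite -[X in bnd X _]addn0; apply: bndX; exact: bnd_dsubmx.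
  by move=> x x0; rewrite -powR_root // divff ?pnatr_eq0 // powRr1 // ltW.
- move=> k kr i.
  have -> : (fun x => submxcol (L k (root x)) i) = (fun x => blk (err (root x)) k i).
    by apply: funext => x; rewrite /L mxcolK.
  apply: (mxO_bnd (err_bnd k i)) => x x0.
  rewrite (delta_root (i := i)) //; last by rewrite -ltnS.
  congr (_ ^+ _); rewrite /wt; case: ifP => kr1.
    have : (0 < rho - k + i)%N by rewrite addn_gt0 subn_gt0 kr1.
    by case: (rho - k + i)%N.
  by case: (nat_of_ord i) => [|j]; rewrite ?min0n //= minnSS.
(* On chain rho the term Q Omega^i is subtracted from every block, at i = 0 as part of the leading
   term; so each block gains one order over its weight i. *)
- move=> i.
  have -> : (fun x => submxcol (L rho (root x) - \mxcol_(i < rho.+1)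
            (if i == 0%N :> nat then 0
             else Q *m ((x `^ (rho.+1%:R^-1))%:C *: Omega) ^+ i)) i) =
      (fun x => (fun e => (e ^+ i)%:C *: blk (Zt e - Z0) rho i) (root x)).
    apply: funext => x; rewrite submxcolB !mxcolK errE wtrho blkB scalerBr Z0Q -addrA -opprD.
    congr (_ - _); case: eqP => [->|/eqP i0].
      by rewrite !expr0 addr0.
    by rewrite scale0r add0r expmxZ rmorphXn -scalemxAr.
  apply: (@mxO_bnd _ rho (i + 1) _ _ (fun e => (e ^+ i)%:C *: blk (Zt e - Z0) rho i)).
    by apply: bndX; exact: bnd_blk.
  by move=> x x0; rewrite /delta ltnn eqxx -powR_root // addn1.
- apply: (@mxO_bnd _ rho 1 _ _ (fun e => OmO e - Omega)); last by move=> x x0; rewrite expr1.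
  have Qa : bnd 1 (fun e => (Qm e)^t* - 1%:M).
    by apply: (bnd_near _ (bnd_adj Q1)); near=> e; rewrite ctmxB ctmx1.
  have D0 : bnd 1 (fun=> DeltaO - DeltaO : 'M[R[i]]_l).
    by exists 0 => //; near=> e; rewrite subrr nrm0 mul0r.
  (* The limit of the product is DeltaO DeltaO Omega = Omega. *)
  have := bnd1M (bnd1M (bnd1M (bnd1M D0 Qa) X1) O1) Q1.
  by rewrite !mulmx1 DD mul1mx.
- have : \forall e \near (0 : R)^'+,
      (H + (e ^+ rho.+1)%:C *: T) *m PhiO e = PhiO e *m ('i%C *: (alpha%:C%:M + e%:C *: OmO e)) /\
      (PhiO e)^t* *m Jmx R n *m PhiO e = (e ^+ rho)%:C *: ('i%C *: DeltaO).
    near=> e.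
    have hQe : (Qm e)^t* *m X e *m Qm e = DeltaO by near: e.
    have QmK : Qm e *m (DeltaO *m (Qm e)^t* *m X e) = 1%:M.
      by apply: mulmx1C; rewrite -!mulmxA (mulmxA _ (X e)) hQe DD.
    have hZe : A0 s (- 'i%C *: HC - alpha%:C%:M) *m (D e *m Z e) -
        (e ^+ rho.+1)%:C *: (B *m (D e *m Z e)) = e%:C *: (D e *m Z e *m Om' e) by near: e.
    have hXe := hX e; rewrite -/(D e) in hXe.
    rewrite /PhiO /Zt (mulmxA (D e)); move: (D e *m Z e) hZe hXe => Y hY hXe; split.
      apply: (perturbed_invariance hHPhi hB).
      rewrite !mulmxA scalemxAl -mulmxBl -!mulmxA hY -scalemxAl; congr (_ *: _).
      rewrite -!mulmxA; congr (_ *m _); rewrite /OmO !mulmxA.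
      by rewrite -(mulmxA _ DeltaO) -(mulmxA (Qm e)) QmK mul1mx.
    have h : Y^t* *m (Delta *m (Y *m Qm e)) = (e ^+ rho)%:C *: (X e *m Qm e).
      by rewrite (mulmxA Delta) (mulmxA (Y^t*)) hXe scalemxAl.
    rewrite (gram_Phi hJPhi) ctmxM -(mulmxA _ (Y^t*)) h -scalemxAr mulmxA hQe.
    by rewrite !scalerA mulrC.
  (* Both identities hold in terms of e; substituting e = x^(1/p) turns e^p into x and e^(p-1) into
     x^(1 - 1/p). *)
  move=> /(near_root rho) h; near=> x; have x0 : 0 < x by [].
  have xE : x = root x ^+ rho.+1 by rewrite /root -powR_root // divff ?pnatr_eq0 // powRr1 // ltW.
  have xE' : x `^ (1 - rho.+1%:R^-1) = root x ^+ rho.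
    rewrite /root -powR_root //; congr (_ `^ _).
    have p0 : rho.+1%:R != 0 :> R by rewrite pnatr_eq0.
    by apply: (mulIf p0); rewrite mulrBl mulVf // divfK // mul1r -natr1 addrK.
  rewrite [X in X%:C *: T]xE xE'; near: x; exact: h.
Unshelve. all: by end_near.
Qed.
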